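(* Assume that $\{P_t\}_{t\ge0}$ satisfies the weak Bakry-Émery condition ${\rm wBE}(\kappa_1,\kappa_2)$ for some $\kappa_1,\kappa_2>0$. Let $2\le p<\infty$ and $$\Psi_p(r)=\sigma_{(1-\frac2p)\frac{\kappa_1}{\beta_1}+\frac1p,\,(1-\frac2p)\frac{\kappa_2}{\beta_2}+\frac1p}(r).$$ Then there exists $C>0$ such that for every $f\in L^p(X,\mu)$ and every $t>0$ $$\|P_tf\|_{p,\Psi_p}\le\frac{C}{\Psi_p(t)}\|f\|_{L^p(X,\mu)}.$$
   Context: Notation: for $\alpha,\beta>0$, $\sigma_{\alpha,\beta}(x):=x^\alpha1_{[0,1]}(x)+x^\beta1_{(1,+\infty)}(x)$, $x\ge0$. Setting: $(X,d)$ is a locally compact complete metric space with open balls $B(x,r)=\{y:d(x,y)<r\}$, $\mu$ is a Radon measure, doubling and positive: there is $C>0$ with $0<\mu(B(x,2r))\le C\mu(B(x,r))<\infty$ for all $x\in X,r>0$. $(\mathcal E,\mathcal F)$ is a Dirichlet form on $L^2(X,\mu)$ with heat semigroup $\{P_t\}_{t\ge0}$, which is conservative ($P_t1=1$). Volume assumption: there are $\alpha_1,\alpha_2\ge1$ and $C>0$ with $C^{-1}\sigma_{\alpha_1,\alpha_2}(r)\le\mu(B(x,r))\le C\sigma_{\alpha_1,\alpha_2}(r)$ for all $x\in X,r>0$. Heat kernel assumption: $\{P_t\}$ has a heat kernel $p_t(x,y)$ (i.e. $P_tf(x)=\int_Xp_t(x,y)f(y)\,d\mu(y)$) and there are $\beta_1,\beta_2$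 with $2\le\beta_i\le1+\alpha_i$ ($i=1,2$) such that $p_t(x,y)$ is bounded above and below by expressions of the form $$\frac{C}{\sigma_{\alpha_1/\beta_1,\alpha_2/\beta_2}(t)}\exp\Big(-c\Big(\frac{d(x,y)^{\beta_1}}t\Big)^{\frac1{\beta_1-1}}\Big)\ \text{if } t<d(x,y),\qquad \frac{C}{\sigma_{\alpha_1/\beta_1,\alpha_2/\beta_2}(t)}\exp\Big(-c\Big(\frac{d(x,y)^{\beta_2}}t\Big)^{\frac1{\beta_2-1}}\Big)\ \text{if } t\ge d(x,y),$$ for $x,y\in X$, $t>0$, with positive constants $c,C$ that may differ in the upper and lower bounds. ${\rm wBE}(\kappa_1,\kappa_2)$: there is $C_{\rm wBE}>0$ with $|P_tf(x)-P_tf(y)|\le C_{\rm wBE}\frac{\sigma_{\kappa_1,\kappa_2}(d(x,y))}{\sigma_{\kappa_1/\beta_1,\kappa_2/\beta_2}(t)}\|f\|_{L^\infty}$ for all $x,y\in X$, $t>0$, $f\in L^\infty(X,\mu)$. Seminorm: for non-decreasing $h:[0,\infty)\to[0,\infty)$ with $h(0)=0$, $\|f\|_{p,h}:=\sup_{t>0}\frac1{h(t)}\big(\int_X\int_X|f(x)-f(y)|^pp_t(x,y)\,d\mu(x)\,d\mu(y)\big)^{1/p}$. *)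

(* Defs.v *)
From HB Require Import structures.
From mathcomp Require Import all_boot all_order all_algebra.
From mathcomp Require Import all_classical all_reals all_analysis.

Set Implicit Arguments.
Unset Strict Implicit.
Unset Printing Implicit Defensive.

Import Order.TTheory GRing.Theory Num.Theory.
Import numFieldNormedType.Exports.

Local Open Scope classical_set_scope.
Local Open Scope ring_scope.

(* The library's complete and measurable types are pointed, so the space is
   nonempty. *)
#[short(type="completeMetricType")]
HB.structure Definition CompleteMetric (R : numDomainType) :=
  {T of Complete T & Metric R T}.

(* X with its Borel sigma-algebra; convertible to X. *)
Notation borel X := (g_sigma_algebraType (@open X)).

(* x^a on [0, 1] and x^b on ]1, +oo[ *)
Definition two_power (R : realType) (a b x : R) : R :=
  x `^ a * \1_`[0, 1] x + x `^ b * \1_`]1, +oo[ x.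

Section metric_measure_space.
Context (R : realType) (X : completeMetricType R).
Variable mu : {measure set (borel X) -> \bar R}.
Local Open Scope ereal_scope.

Record radon : Prop := {
  radon_compact : forall K : set X, compact K -> mu K < +oo ;
  radon_outer : forall A : set (borel X), measurable A ->
    mu A = ereal_inf [set mu U | U in [set U : set X | open U /\ A `<=` U]] ;
  radon_inner : forall U : set X, open U ->
    mu U = ereal_sup [set mu K | K in [set K : set X | compact K /\ K `<=` U]]
}.

Definition doubling_positive : Prop := exists2 C : R, (0 < C)%R &
  forall (x : X) (r : R), (0 < r)%R ->
    [/\ 0 < mu (ball x (2 * r)%R),
        mu (ball x (2 * r)%R) <= C%:E * mu (ball x r) &
        C%:E * mu (ball x r) < +oo].

Definition volume_growth (alpha1 alpha2 : R) : Prop :=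
  exists2 C : R, (0 < C)%R &
  forall (x : X) (r : R), (0 < r)%R ->
    (C^-1 * two_power alpha1 alpha2 r)%:E <= mu (ball x r) /\
    mu (ball x r) <= (C * two_power alpha1 alpha2 r)%:E.

End metric_measure_space.

(* Elements of L^p are handled through representatives f \in Lfun mu p; the
   domain F, the form E and the operators P t are required to respect
   mu-almost everywhere equality. *)
Section dirichlet_forms.
Context d (T : measurableType d) (R : realType).
Variable mu : {measure set T -> \bar R}.

Definition L2 : set (T -> R) := [set f | f \in Lfun mu 2%:E].

Definition L2dot (f g : T -> R) : R := \int[mu]_x (f x * g x).

Record dirichlet_form (F : set (T -> R)) (E : (T -> R) -> (T -> R) -> R) :
    Prop := {
  form_L2 : F `<=` L2 ;
  form_ae : forall f g, F f -> L2 g -> f = g %[ae mu] ->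
    F g /\ forall h, F h -> E f h = E g h ;
  form_dom0 : F 0 ;
  form_domP : forall (a : R) f g, F f -> F g -> F (a *: f + g) ;
  form_dense : forall f, L2 f -> forall e : R, 0 < e ->
    exists2 g, F g & ('N[mu]_2%:E[EFin \o (f - g)%R] < e%:E)%E ;
  form_linear : forall (a : R) f g h, F f -> F g -> F h ->
    E (a *: f + g) h = a * E f h + E g h ;
  form_sym : forall f g, F f -> F g -> E f g = E g f ;
  form_ge0 : forall f, F f -> 0 <= E f f ;
  form_closed : forall u : nat -> T -> R, (forall n, F (u n)) ->
    (forall e : R, 0 < e -> exists N : nat, forall m n : nat,
      (N <= m)%N -> (N <= n)%N ->
      E (u m - u n) (u m - u n) + L2dot (u m - u n) (u m - u n) < e) ->
    exists2 f, F f &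
      (E (u n - f) (u n - f) + L2dot (u n - f) (u n - f)) @[n --> \oo]
        --> (0 : R) ;
  form_markov : forall f, F f ->
    let g := fun x => Num.min (Num.max (f x) 0) 1 in
    F g /\ E g g <= E f f
}.

(* g is the value at f of the infinitesimal generator of P:
   (P_t f - f) / t tends to g in L^2 as t tends to 0 from the right. *)
Definition generator_value (P : R -> (T -> R) -> (T -> R)) (f g : T -> R) :
    Prop :=
  ('N[mu]_2%:E[EFin \o (t^-1 *: (P t f - f) - g)%R])%E @[t --> 0^'+] --> 0%E.

(* P is the strongly continuous symmetric contraction semigroup on L^2 whose
   generator A is that of the form: f \in D(A) and A f = g if and only if
   f \in F and E(f, h) = - <g, h> for all h \in F. *)
Record heat_semigroup (F : set (T -> R)) (E : (T -> R) -> (T -> R) -> R)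
    (P : R -> (T -> R) -> (T -> R)) : Prop := {
  heat_L2 : forall (t : R) f, 0 <= t -> L2 f -> L2 (P t f) ;
  heat_ae : forall (t : R) f g, 0 <= t -> L2 f -> L2 g -> f = g %[ae mu] ->
    P t f = P t g %[ae mu] ;
  heat_linear : forall (t a : R) f g, 0 <= t -> L2 f -> L2 g ->
    P t (a *: f + g) = a *: P t f + P t g %[ae mu] ;
  heat_0 : forall f, L2 f -> P 0 f = f %[ae mu] ;
  heat_add : forall (s t : R) f, 0 <= s -> 0 <= t -> L2 f ->
    P (s + t) f = P s (P t f) %[ae mu] ;
  heat_contraction : forall (t : R) f, 0 <= t -> L2 f ->
    ('N[mu]_2%:E[EFin \o P t f] <= 'N[mu]_2%:E[EFin \o f])%E ;
  heat_symmetric : forall (t : R) f g, 0 <= t -> L2 f -> L2 g ->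
    L2dot (P t f) g = L2dot f (P t g) ;
  heat_continuous : forall f, L2 f ->
    ('N[mu]_2%:E[EFin \o (P t f - f)%R])%E @[t --> 0^'+] --> 0%E ;
  heat_generator : forall f g, L2 f -> L2 g ->
    (generator_value P f g <-> F f /\ forall h, F h -> E f h = - L2dot g h)
}.

(* The pointwise defined function x |-> \int p_t(x, y) f(y) dmu(y). For t > 0
   it is P_t f, also for f in L^q with q != 2. *)
Definition kernel_op (p : R -> T -> T -> R) (t : R) (f : T -> R) : T -> R :=
  fun x => \int[mu]_y (p t x y * f y).

Definition heat_kernel (P : R -> (T -> R) -> (T -> R)) (p : R -> T -> T -> R) :
    Prop :=
  forall t : R, 0 < t ->
    measurable_fun [set: T * T] (fun z => p t z.1 z.2) /\
    forall f, L2 f -> P t f = kernel_op p t f %[ae mu].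

Definition conservative (p : R -> T -> T -> R) : Prop :=
  forall t : R, 0 < t -> kernel_op p t (cst 1) = cst 1 %[ae mu].

(* With the extended reals' convention 1 / 0 = +oo where h vanishes. *)
Definition heat_seminorm (p : R -> T -> T -> R) (q : R) (h : R -> R)
    (f : T -> R) : \bar R :=
  ereal_sup [set ((h t)%:E^-1 *
    (\int[mu]_y \int[mu]_x (`|f x - f y| `^ q * p t x y)%:E) `^ q^-1)%E
    | t in [set t : R | 0 < t]].

End dirichlet_forms.

Section heat_kernel_conditions.
Context (R : realType) (X : completeMetricType R).
Variable mu : {measure set (borel X) -> \bar R}.

Definition subgaussian (alpha1 alpha2 beta1 beta2 c C t r : R) : R :=
  C / two_power (alpha1 / beta1) (alpha2 / beta2) t *
  expR (- c * (if t < r then (r `^ beta1 / t) `^ (beta1 - 1)^-1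
               else (r `^ beta2 / t) `^ (beta2 - 1)^-1)).

Definition heat_kernel_estimates (alpha1 alpha2 beta1 beta2 : R)
    (p : R -> X -> X -> R) : Prop :=
  exists c1 C1 c2 C2 : R, [/\ 0 < c1, 0 < C1, 0 < c2, 0 < C2 &
    forall (x y : X) (t : R), 0 < t ->
      subgaussian alpha1 alpha2 beta1 beta2 c1 C1 t (mdist x y) <= p t x y /\
      p t x y <= subgaussian alpha1 alpha2 beta1 beta2 c2 C2 t (mdist x y)].

Definition wBE (beta1 beta2 kappa1 kappa2 : R) (p : R -> X -> X -> R) : Prop :=
  exists2 C : R, 0 < C &
  forall (x y : X) (t : R) (f : borel X -> R), 0 < t -> f \in Lfun mu +oo%E ->
    (`|kernel_op mu p t f x - kernel_op mu p t f y|%:E <=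
     (C * (two_power kappa1 kappa2 (mdist x y) /
           two_power (kappa1 / beta1) (kappa2 / beta2) t))%:E *
     'N[mu]_+oo[EFin \o f])%E.

End heat_kernel_conditions.

(* Main.v *)
Require Import Defs.
From HB Require Import structures.
From mathcomp Require Import all_boot all_order all_algebra.
From mathcomp Require Import all_classical all_reals all_analysis.
From mathcomp Require Import measurable_realfun ess_sup_inf.
From mathcomp Require Import ring lra.

Set Implicit Arguments.
Unset Strict Implicit.
Unset Printing Implicit Defensive.

Import Order.TTheory GRing.Theory Num.Theory.
Import numFieldNormedType.Exports.

Local Open Scope classical_set_scope.
Local Open Scope ring_scope.

(** Put u = P_t f. The claim is that the integral of |u(x) - u(y)|^p p_s(x, y)
    over pairs is at most a constant times (Psi_p(s) / Psi_p(t))^p ||f||_p^p,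
    where Psi_p(r)^p = S(r)^(p - 2) r with S = sigma_{kappa1/beta1, kappa2/beta2}.
    It interpolates between two estimates for the differences of P_t f.

    For p = 2, expanding the square and using that p_s has mass one in each
    variable (conservativity and symmetry) turns the integral into
    2 <(1 - P_s) P_t f, P_t f>, and this is at most 2 (s / t) ||f||_2^2 because
    r |-> <P_r f, f> is nonnegative, bounded by ||f||_2^2 and midpoint convex
    ([heat_quadratic_estimate]).

    For bounded f, wBE gives |u(x) - u(y)| <= D(x, y) ||f||_oo, where
    D(x, y) = C sigma_{kappa1, kappa2}(d(x, y)) / S(t).

    For p > 2, cut f at the levels 2^k. At a pair (x, y) the level comparable to
    |u(x) - u(y)| / D(x, y) makes the contribution of the lower part of f at
    most half of the difference, so |u(x) - u(y)|^p is controlled by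
    D(x, y)^(p - 2) times the sum over k of 2^(k (p - 2)) times the squared
    difference of P_t applied to the part of f above 2^k. The quadratic estimate
    bounds the integral of each square, and the squared norms of the upper
    parts sum up to ||f||_p^p ([kernel_difference_Lp]).

    The factor D^(p - 2) is not constant. The two-sided kernel bounds absorb it:
    D^(p - 2) p_s is at most a constant times (S(s) / S(t))^(p - 2) p_{L s} for a
    large L, since beyond the diffusion scale of time s the subgaussian factor
    beats every power of the distance ([distance_power_absorption]). *)

(** * Two-regime powers and the heat kernel bounds *)

Section two_power.
Context (R : realType).
Implicit Types a b m x y L t r : R.

Lemma powR_le x y r : 0 <= r -> 0 <= x -> x <= y -> x `^ r <= y `^ r.
Proof.
move=> r0 x0 xy; apply: ge0_ler_powR => //; rewrite nnegrE//.
exact: le_trans xy.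
Qed.

Lemma powR_le1 x r : 0 <= r -> 0 <= x -> x <= 1 -> x `^ r <= 1.
Proof. by move=> r0 x0 x1; have := powR_le r0 x0 x1; rewrite powR1. Qed.

Lemma powR_ge1 x r : 0 <= r -> 1 <= x -> 1 <= x `^ r.
Proof. by move=> r0 x1; have := ler_powR x1 r0; rewrite powRr0. Qed.

Lemma powR_div x y r : 0 <= x -> 0 <= y -> (x / y) `^ r = x `^ r / y `^ r.
Proof.
move=> x0 y0; rewrite powRM ?invr_ge0//; congr (_ * _).
by rewrite -powR_inv1// -powRrM mulN1r powRN.
Qed.

Lemma two_powerE a b x : 0 <= x ->
  two_power a b x = if x <= 1 then x `^ a else x `^ b.
Proof.
move=> x0; rewrite /two_power !indicE !mem_setE !in_itv/= x0 andbT/=.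
by case: leP => _; rewrite mulr1 mulr0 ?addr0 ?add0r.
Qed.

Lemma two_power_ge0 a b x : 0 <= x -> 0 <= two_power a b x.
Proof. by move=> x0; rewrite two_powerE//; case: ifP => _; exact: powR_ge0. Qed.

Lemma two_power_gt0 a b x : 0 < x -> 0 < two_power a b x.
Proof.
by move=> x0; rewrite two_powerE ?(ltW x0)//; case: ifP => _; exact: powR_gt0.
Qed.

Lemma le_two_power a b x y : 0 <= a -> 0 <= b -> 0 <= x -> x <= y ->
  two_power a b x <= two_power a b y.
Proof.
move=> a0 b0 x0 xy; have y0 := le_trans x0 xy.
rewrite !two_powerE//; case: (leP x 1) => x1; case: (leP y 1) => y1.
- exact: powR_le.
- by rewrite (le_trans (powR_le1 a0 x0 x1))// powR_ge1// ltW.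
- by have := lt_le_trans x1 (le_trans xy y1); rewrite ltxx.
- exact: powR_le.
Qed.

Lemma two_powerN a b x : 0 <= x ->
  two_power (- a) (- b) x = (two_power a b x)^-1.
Proof. by move=> x0; rewrite !two_powerE// !powRN; case: ifP. Qed.

(** An upper bound on both exponents bounds the growth under dilation: across
    the threshold the factor splits as (L * x) ^ m with x <= 1 <= L * x. *)
Lemma two_power_dilation a b m L x : 1 <= L -> a <= m -> b <= m -> 0 < x ->
  two_power a b (L * x) <= L `^ m * two_power a b x.
Proof.
move=> L1 am bm x0; have L0 : 0 < L by exact: lt_le_trans L1.
have Lx0 : 0 < L * x by exact: mulr_gt0.
rewrite !two_powerE ?(ltW x0) ?(ltW Lx0)//.
case: (leP x 1) => x1; case: (leP (L * x) 1) => Lx1.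
- by rewrite powRM ?(ltW L0) ?(ltW x0)// ler_wpM2r ?powR_ge0// ler_powR.
- apply: (@le_trans _ _ ((L * x) `^ m)); first by apply: ler_powR => //; exact: ltW.
  rewrite powRM ?(ltW L0) ?(ltW x0)// ler_wpM2l ?powR_ge0//.
  by apply: ger_powR => //; rewrite x0.
- have : x <= L * x by rewrite ler_peMl// ltW.
  by move=> xLx; have := lt_le_trans x1 (le_trans xLx Lx1); rewrite ltxx.
- by rewrite powRM ?(ltW L0) ?(ltW x0)// ler_wpM2r ?powR_ge0// ler_powR.
Qed.

Lemma two_power_contraction a b m L x : 1 <= L -> m <= a -> m <= b -> 0 < x ->
  two_power a b (x / L) <= L `^ (- m) * two_power a b x.
Proof.
move=> L1 ma mb x0; have L0 : 0 < L by exact: lt_le_trans L1.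
have xL0 : 0 < x / L by exact: divr_gt0.
have := @two_power_dilation (- a) (- b) (- m) L (x / L) L1.
rewrite !lerN2 => /(_ ma mb xL0).
rewrite mulrC divfK ?gt_eqF// !two_powerN ?(ltW x0) ?(ltW xL0)//.
rewrite -(@ler_pM2r _ (two_power a b (x / L))) ?two_power_gt0//.
rewrite mulfVK ?gt_eqF ?two_power_gt0//.
rewrite mulrC -ler_pdivlMr ?invr_gt0 ?two_power_gt0//.
by rewrite invrK.
Qed.

Lemma two_power_comp a1 a2 b1 b2 x : 0 < b1 -> 0 < b2 -> 0 < x ->
  two_power a1 a2 (two_power b1^-1 b2^-1 x) = two_power (a1 / b1) (a2 / b2) x.
Proof.
move=> b10 b20 x0; rewrite two_powerE ?two_power_ge0 ?(ltW x0)//.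
rewrite !two_powerE ?(ltW x0)//.
case: (leP x 1) => x1.
- have -> : x `^ b1^-1 <= 1.
    by apply: powR_le1; rewrite ?invr_ge0 ?(ltW x0) ?(ltW b10).
  by rewrite -powRrM mulrC.
- have : 1 < x `^ b2^-1.
    rewrite -[ltLHS](powRr0 x) /powR gt_eqF// ltr_expR mul0r.
    by rewrite mulr_gt0 ?invr_gt0 ?ln_gt0.
  by rewrite ltNge => /negbTE ->; rewrite -powRrM mulrC.
Qed.

Lemma two_power_affine u e a b x : 0 < x ->
  two_power (u * a + e) (u * b + e) x = (two_power a b x) `^ u * x `^ e.
Proof.
move=> x0; rewrite !two_powerE ?(ltW x0)//; case: ifP => _;
  by rewrite powRD ?(gt_eqF x0) ?implybT// [u * _]mulrC powRrM.
Qed.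

End two_power.

Section exponent.
Context (R : realType) (beta1 beta2 : R).
Hypotheses (b1 : 2 <= beta1) (b2 : 2 <= beta2).
Implicit Types t r L : R.

Let g1 := (beta1 - 1)^-1.
Let g2 := (beta2 - 1)^-1.

Let b1_gt1 : 1 < beta1. Proof. by rewrite (lt_le_trans _ b1)// ltr1n. Qed.
Let b2_gt1 : 1 < beta2. Proof. by rewrite (lt_le_trans _ b2)// ltr1n. Qed.
Let g10 : 0 < g1. Proof. by rewrite invr_gt0 subr_gt0. Qed.

(** The exponent of the heat kernel bounds, rewritten as the distance times a
    two-regime power of distance over time; in this form a change of time is a
    dilation. *)
Definition heat_exponent t r := r * two_power g2 g1 (r / t).

Lemma heat_exponent_ge0 t r : 0 < t -> 0 <= r -> 0 <= heat_exponent t r.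
Proof.
by move=> t0 r0; rewrite mulr_ge0// two_power_ge0// divr_ge0// ltW.
Qed.

Let powR_exponent b t r : 1 < b -> 0 < t -> 0 <= r ->
  (r `^ b / t) `^ (b - 1)^-1 = r * (r / t) `^ (b - 1)^-1.
Proof.
move=> b_gt1 t0; rewrite le_eqVlt => /predU1P[<-|r0].
  by rewrite mul0r powR0 ?mul0r ?powR0 ?invr_eq0//; lra.
rewrite !powRM ?powR_ge0 ?invr_ge0 ?(ltW r0) ?(ltW t0)// mulrA; congr (_ * _).
have bE : b / (b - 1) = 1 + (b - 1)^-1.
  by rewrite -{1}(subrK 1 b) mulrDl divff ?mul1r//; lra.
by rewrite -powRrM bE powRD ?powRr1 ?(ltW r0)// (gt_eqF r0) implybT.
Qed.

Lemma subgaussianE alpha1 alpha2 (c C t r : R) : 0 < t -> 0 <= r ->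
  subgaussian alpha1 alpha2 beta1 beta2 c C t r =
  C / two_power (alpha1 / beta1) (alpha2 / beta2) t *
  expR (- c * heat_exponent t r).
Proof.
move=> t0 r0; rewrite /subgaussian; congr (_ * expR (_ * _)).
rewrite /heat_exponent two_powerE ?divr_ge0 ?(ltW t0)//.
rewrite ler_pdivrMr// mul1r leNgt.
by case: (t < r) => /=; exact: powR_exponent.
Qed.

Lemma heat_exponent_dilation m L t r : 1 <= L -> m <= g1 -> m <= g2 ->
  0 < t -> 0 <= r ->
  heat_exponent (L * t) r <= L `^ (- m) * heat_exponent t r.
Proof.
move=> L1 m1 m2 t0; rewrite le_eqVlt => /predU1P[<-|r0].
  by rewrite /heat_exponent !mul0r mulr0.
rewrite /heat_exponent mulrCA ler_wpM2l ?(ltW r0)//.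
rewrite invfM [L^-1 * _]mulrC mulrA; apply: two_power_contraction => //.
exact: divr_gt0.
Qed.

Let scale_exponent b t r : 1 < b -> 0 < t -> t `^ b^-1 <= r ->
  r <= t `^ b^-1 * (r * (r / t) `^ (b - 1)^-1).
Proof.
move=> b_gt1 t0 tr; have r0 : 0 < r by rewrite (lt_le_trans _ tr)// powR_gt0.
rewrite mulrCA ler_peMr ?(ltW r0)//.
have E : t `^ b^-1 * (t `^ b^-1 / t) `^ (b - 1)^-1 = 1.
  rewrite -{3}(powRr1 (ltW t0)) -powRB ?(gt_eqF t0) ?implybT// -powRrM -powRD.
    have -> : b^-1 + (b^-1 - 1) / (b - 1) = 0 by field; lra.
    by rewrite powRr0.
  by rewrite (gt_eqF t0) implybT.
rewrite -[leLHS]E ler_wpM2l ?powR_ge0//; apply: powR_le.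
- by rewrite invr_ge0; lra.
- by rewrite divr_ge0 ?powR_ge0// ltW.
- by rewrite ler_wpM2r// invr_ge0 ltW.
Qed.

(** Beyond the diffusion scale of time t the exponent dominates the ratio of
    the distance to that scale. The four cases are the two regimes of the
    scale (t <= 1 or not) and of the exponent (r <= t or not); when the
    regimes disagree the bound is immediate. *)
Lemma le_scale_exponent t r : 0 < t -> 0 <= r ->
  r <= two_power beta1^-1 beta2^-1 t * Num.max 1 (heat_exponent t r).
Proof.
move=> t0 r0; set rho := two_power _ _ t.
have rho0 : 0 < rho by exact: two_power_gt0.
have [rrho|rhor] := leP r rho.
  by rewrite (le_trans rrho)// ler_peMr ?(ltW rho0)// le_max lexx.
suff H : r <= rho * heat_exponent t r.
  by rewrite (le_trans H)// ler_wpM2l ?(ltW rho0)// le_max lexx orbT.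
move: rhor; rewrite /rho /heat_exponent !two_powerE ?divr_ge0 ?(ltW t0)//.
rewrite ler_pdivrMr// mul1r.
case: (leP t 1) => t1; case: (leP r t) => rt rhor.
- have : t <= t `^ beta1^-1.
    by rewrite ger1_powR ?t0 ?t1// invf_le1 ?(ltW b1_gt1)// (lt_trans ltr01).
  by lra.
- by apply: scale_exponent => //; exact: ltW.
- by apply: scale_exponent => //; exact: ltW.
- rewrite mulrCA ler_peMr// -[1]mulr1 ler_pM//.
    by rewrite powR_ge1 ?invr_ge0 ?(ltW t1)// (le_trans _ b2)// ler0n.
  by rewrite powR_ge1 ?(ltW g10)// ler_pdivlMr// mul1r ltW.
Qed.

End exponent.

Section comparison.
Context (R : realType).

Lemma max1_powR_le_expR (n d : R) : 0 <= n -> 0 < d ->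
  exists2 K : R, 0 < K &
    forall e, 0 <= e -> Num.max 1 e `^ n <= K * expR (d * e).
Proof.
(* the n + 1 allows n = 0 and still gives n * d' <= d *)
move=> n0 d0; pose d' := d / (n + 1).
have d'0 : 0 < d' by rewrite divr_gt0//; lra.
exists ((1 + d'^-1) `^ n); first by rewrite powR_gt0// addr_gt0 ?invr_gt0.
move=> e e0; apply: (@le_trans _ _ (((1 + d'^-1) * expR (d' * e)) `^ n)).
  apply: powR_le => //; first by rewrite le_max ler01.
  apply: (@le_trans _ _ ((1 + d'^-1) * (1 + d' * e))); last first.
    by rewrite ler_wpM2l ?expR_ge1Dx// addr_ge0 ?invr_ge0// ltW.
  have -> : (1 + d'^-1) * (1 + d' * e) = 1 + e + (d'^-1 + d' * e).
    by field; rewrite gt_eqF.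
  have d'e : 0 <= d' * e by rewrite mulr_ge0// ltW.
  have d'V : 0 < d'^-1 by rewrite invr_gt0.
  by rewrite ge_max; apply/andP; split; lra.
rewrite powRM ?expR_ge0//; last by rewrite addr_ge0 ?invr_ge0// ltW.
rewrite ler_wpM2l ?powR_ge0// -expRM ler_expR mulrAC ler_wpM2r//.
rewrite /d' mulrAC ler_pdivrMr; last lra.
by nra.
Qed.

(** A power of the distance, measured against the same power of the diffusion
    scale, is absorbed by the subgaussian factor at the price of a larger time.
    Dilating the time by L multiplies the exponent by at most L ^ (- m), which
    makes room both for the constant of the lower bound and for half of the
    exponential decay, and the latter swallows the polynomial factor. *)
Lemma distance_power_absorption (alpha1 alpha2 beta1 beta2 kappa1 kappa2 q
    c1 C1 c2 C2 : R) :
  2 <= beta1 -> 2 <= beta2 -> 0 < kappa1 -> 0 < kappa2 -> 0 <= q ->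
  0 < c1 -> 0 < C1 -> 0 < c2 -> 0 < C2 ->
  exists L K : R, [/\ 1 <= L, 0 < K & forall t r, 0 < t -> 0 <= r ->
    two_power kappa1 kappa2 r `^ q *
      subgaussian alpha1 alpha2 beta1 beta2 c2 C2 t r <=
    K * two_power (kappa1 / beta1) (kappa2 / beta2) t `^ q *
      subgaussian alpha1 alpha2 beta1 beta2 c1 C1 (L * t) r].
Proof.
move=> b1 b2 k1 k2 q0 c10 C10 c20 C20.
pose m := Num.min (beta1 - 1)^-1 (beta2 - 1)^-1.
have m0 : 0 < m by rewrite lt_min !invr_gt0; apply/andP; split; lra.
pose L := Num.max 1 ((2 * c1 / c2) `^ m^-1).
have L1 : 1 <= L by rewrite le_max lexx.
have L0 : 0 < L by exact: lt_le_trans L1.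
have cL : c1 * L `^ (- m) <= c2 / 2.
  have cc0 : 0 <= 2 * c1 / c2 by rewrite ltW// divr_gt0// mulr_gt0.
  have : 2 * c1 / c2 <= L `^ m.
    rewrite -[leLHS](powRr1 cc0) -[X in _ `^ X](mulVf (lt0r_neq0 m0)) powRrM.
    by apply: powR_le; rewrite ?powR_ge0 ?(ltW m0)// /L le_max lexx orbT.
  by rewrite ler_pdivrMr// powRN => ?; rewrite ler_pdivrMr ?powR_gt0//; lra.
pose k := Num.max kappa1 kappa2.
have k0 : 0 <= k by rewrite le_max (ltW k1).
have c22 : 0 < c2 / 2 by rewrite divr_gt0.
have [K1 K10 HK1] := @max1_powR_le_expR (k * q) (c2 / 2) (mulr_ge0 k0 q0) c22.
pose M := Num.max (alpha1 / beta1) (alpha2 / beta2).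
exists L, (K1 * C2 / C1 * L `^ M); split; first exact: L1.
  by rewrite mulr_gt0 ?powR_gt0// divr_gt0// mulr_gt0.
move=> t r t0 r0; have Lt0 : 0 < L * t by exact: mulr_gt0.
rewrite !subgaussianE//.
set A := two_power (alpha1 / beta1) _.
set S := two_power (kappa1 / beta1) _ t; set E := heat_exponent _ _.
have E0 : 0 <= E t r by exact: heat_exponent_ge0.
have S0 : 0 < S by exact: two_power_gt0.
have At0 : 0 < A t by exact: two_power_gt0.
have ALt0 : 0 < A (L * t) by exact: two_power_gt0.
have dist_le : two_power kappa1 kappa2 r <= Num.max 1 (E t r) `^ k * S.
  apply: le_trans (le_two_power (ltW k1) (ltW k2) r0
    (le_scale_exponent b1 b2 t0 r0)) _.
  rewrite mulrC (le_trans (@two_power_dilation _ _ _ k _ _ _ _ _ _))//.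
  - by rewrite le_max lexx.
  - by rewrite le_max lexx.
  - by rewrite le_max lexx orbT.
  - exact: two_power_gt0.
  - by rewrite two_power_comp//; lra.
have distq : two_power kappa1 kappa2 r `^ q <=
    K1 * expR (c2 / 2 * E t r) * S `^ q.
  apply: (@le_trans _ _ ((Num.max 1 (E t r) `^ k * S) `^ q)).
    by apply: powR_le => //; exact: two_power_ge0.
  rewrite powRM ?powR_ge0 ?(ltW S0)// ler_wpM2r ?powR_ge0// -powRrM.
  exact: HK1.
have AL : (A t)^-1 <= L `^ M / A (L * t).
  rewrite ler_pdivlMr// mulrC ler_pdivrMr//.
  apply: two_power_dilation => //; first by rewrite le_max lexx.
  by rewrite le_max lexx orbT.
have expL : expR (c2 / 2 * E t r) * expR (- c2 * E t r) <=
    expR (- c1 * E (L * t) r).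
  rewrite -expRD ler_expR.
  have EL : E (L * t) r <= L `^ (- m) * E t r.
    apply: heat_exponent_dilation => //; first by rewrite ge_min lexx.
    by rewrite ge_min lexx orbT.
  have : c1 * E (L * t) r <= c1 * (L `^ (- m) * E t r) by rewrite ler_wpM2l// ltW.
  have : c1 * L `^ (- m) * E t r <= c2 / 2 * E t r by rewrite ler_wpM2r.
  by lra.
apply: (@le_trans _ _ (K1 * expR (c2 / 2 * E t r) * S `^ q *
    (C2 / A t * expR (- c2 * E t r)))).
  by rewrite ler_wpM2r// mulr_ge0 ?expR_ge0// divr_ge0// ltW.
have -> : K1 * expR (c2 / 2 * E t r) * S `^ q *
    (C2 / A t * expR (- c2 * E t r)) =
    (K1 * C2 * S `^ q) *
    ((A t)^-1 * (expR (c2 / 2 * E t r) * expR (- c2 * E t r))) by ring.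
have -> : K1 * C2 / C1 * L `^ M * S `^ q *
    (C1 / A (L * t) * expR (- c1 * E (L * t) r)) =
    (K1 * C2 * S `^ q) * ((L `^ M / A (L * t)) * expR (- c1 * E (L * t) r)).
  by field; rewrite !gt_eqF.
rewrite ler_wpM2l//; first by rewrite !mulr_ge0 ?powR_ge0// ltW.
by rewrite ler_pM ?mulr_ge0 ?expR_ge0// invr_ge0 ltW.
Qed.

End comparison.

(** * Dyadic levels *)

Section dyadic.
Context (R : realType).
Implicit Types a c q r v : R.

Lemma geometric_truncated_sum r c a (N : nat) : 1 < r -> 0 < c -> 0 <= a ->
  \sum_(m < N) (if c * r ^+ m < a then c * r ^+ m else 0) <= r / (r - 1) * a.
Proof.
move=> r1 c0 a0; have r10 : 0 < r - 1 by rewrite subr_gt0.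
have r0 : 0 < r by exact: lt_trans r1.
elim: N => [|N IH].
  by rewrite big_ord0 mulr_ge0// divr_ge0// ltW.
rewrite big_ord_recr/=; case: ifPn => [cNa|_]; last by rewrite addr0.
(* all earlier terms are counted: the sum is at most the full geometric sum,
   whose last term is below a *)
apply: (@le_trans _ _ (\sum_(m < N.+1) c * r ^+ m)).
  rewrite big_ord_recr/= lerD2r; apply: ler_sum => m _; case: ifP => // _.
  by rewrite mulr_ge0 ?exprn_ge0// ltW.
rewrite -mulr_sumr -(ler_pM2l r10) mulrCA.
have -> : (r - 1) * \sum_(m < N.+1) r ^+ m = r ^+ N.+1 - 1 by rewrite -subrX1.
rewrite mulrA mulrCA divff ?gt_eqF// mulr1 exprS mulrBr mulr1.
rewrite (@le_trans _ _ (r * (c * r ^+ N)))//; first by rewrite mulrCA; lra.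
by rewrite ler_wpM2l ?ltW.
Qed.

(** The powers of two with exponent in the integers, listed over the naturals:
    even positions go up from 1, odd positions go down from 1/2. *)
Definition dyadic_level (n : nat) : R :=
  if odd n then 2 ^- (n./2.+1) else 2 ^+ n./2.

Lemma dyadic_level_gt0 n : 0 < dyadic_level n.
Proof. by rewrite /dyadic_level; case: ifP; rewrite ?invr_gt0 exprn_gt0. Qed.

Let exists_power v : 1 <= v -> exists n, 2 ^+ n <= v <= 2 * 2 ^+ n.
Proof.
move=> v1; have [m vm] : exists m, v <= 2 ^+ m.
  exists (Num.truncn v).+1; rewrite (le_trans (ltW (truncnS_gt v)))//.
  by rewrite -natrX ler_nat ltnW// ltn_expl.
have ex : exists m, (fun m => v <= 2 ^+ m) m by exists m.
case: (ex_minnP ex) => -[|n] vn minn.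
  by exists 0; rewrite expr0 v1/= mulr1 (le_trans vn)// expr0 ler1n.
exists n; rewrite -exprS vn andbT leNgt; apply/negP => /ltW /minn.
by rewrite ltnn.
Qed.

Lemma dyadic_level_approx v : 0 < v ->
  exists n, dyadic_level n <= v <= 2 * dyadic_level n.
Proof.
move=> v0; have [v1|v1] := leP 1 v.
  have [n nv] := exists_power v1.
  by exists n.*2; rewrite /dyadic_level odd_double doubleK.
have [n /andP[nv vn]] : exists n, 2 ^+ n <= v^-1 <= 2 * 2 ^+ n.
  by apply: exists_power; rewrite invf_ge1// ltW.
exists n.*2.+1; rewrite /dyadic_level/= odd_double/= uphalf_double exprS.
have n0 : 0 < 2 ^+ n :> R by rewrite exprn_gt0.
apply/andP; split.
  by rewrite -[leRHS]invrK lef_pV2 ?posrE ?mulr_gt0 ?invr_gt0.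
by rewrite invfM mulVKf// -[leLHS]invrK lef_pV2 ?posrE ?invr_gt0.
Qed.

(** Both halves of the list are geometric with ratio 2 ^ q; the descending half
    is read backwards from its smallest term. *)
Lemma dyadic_level_truncated_sum q : 0 < q -> exists2 K : R, 0 < K &
  forall a (N : nat), 0 <= a ->
    \sum_(n < N) (if dyadic_level n < a then dyadic_level n `^ q else 0) <=
    K * a `^ q.
Proof.
move=> q0; pose r : R := 2 `^ q; have r0 : 0 < r by exact: powR_gt0.
have r1 : 1 < r by rewrite /r /powR gt_eqF// expR_gt1 mulr_gt0 ?ln_gt0 ?ltr1n.
exists (2 * (r / (r - 1))).
  by rewrite mulr_gt0// divr_gt0// subr_gt0.
move=> a N a0; pose G x : R := if x < a `^ q then x else 0.
have FG n : (if dyadic_level n < a then dyadic_level n `^ q else 0) =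
    G (dyadic_level n `^ q).
  have l0 := dyadic_level_gt0 n; rewrite /G; congr (if _ then _ else _).
  have [la|al] := ltP (dyadic_level n) a.
    by rewrite gt0_ltr_powR ?nnegrE ?(ltW l0).
  by apply/esym/negbTE; rewrite -leNgt; apply: powR_le; rewrite ?(ltW q0).
have G0 x : 0 <= x -> 0 <= G x by rewrite /G; case: ifP.
under eq_bigr do rewrite FG.
have power_level m : (2 ^+ m) `^ q = r ^+ m.
  rewrite -(@powR_mulrn _ 2)// -powRrM mulrC powRrM.
  by rewrite (@powR_mulrn _ r) ?powR_ge0.
have even_level m : dyadic_level m.*2 `^ q = 1 * r ^+ m.
  by rewrite /dyadic_level odd_double doubleK mul1r power_level.
have odd_level m : dyadic_level m.*2.+1 `^ q = r ^- m.+1.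
  rewrite /dyadic_level/= odd_double/= uphalf_double.
  rewrite -[X in X `^ q]powR_inv1 ?exprn_ge0// -powRrM mulN1r powRN.
  by rewrite power_level.
apply: (@le_trans _ _ (\sum_(n < N.*2) G (dyadic_level n `^ q))).
  rewrite -addnn big_split_ord/= lerDl.
  by apply: sumr_ge0 => i _; exact/G0/powR_ge0.
have splitD (F : nat -> R) :
    \sum_(n < N.*2) F n = \sum_(m < N) F m.*2 + \sum_(m < N) F m.*2.+1.
  by elim: N => [|N IH]; rewrite ?big_ord0 ?addr0// doubleS !big_ord_recr/= IH; ring.
rewrite (splitD (fun n => G (dyadic_level n `^ q))).
have sum_le c : 0 < c -> \sum_(m < N) G (c * r ^+ m) <= r / (r - 1) * a `^ q.
  by move=> c0; exact/geometric_truncated_sum/powR_ge0.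
rewrite -mulrA mulr_natl mulr2n; apply: lerD.
  by under eq_bigr do rewrite even_level; exact: sum_le.
under eq_bigr do rewrite odd_level.
rewrite (reindex_inj rev_ord_inj)/=.
rewrite (eq_bigr (fun m : 'I_N => G (r ^- N * r ^+ m))); last first.
  move=> m _; congr G; rewrite subnSK// exprB ?unitfE ?gt_eqF// 1?ltnW//.
  by rewrite invf_div mulrC.
by apply: sum_le; rewrite invr_gt0 exprn_gt0.
Qed.

End dyadic.

(** * Square-integrable functions *)

Section square_integrable.
Context d (T : measurableType d) (R : realType).
Variable mu : {measure set T -> \bar R}.
Implicit Types f g : T -> R.

Lemma Lfun_measurable (r : \bar R) f : f \in Lfun mu r -> measurable_fun setT f.
Proof. by rewrite inE => /andP[+ _]; rewrite inE. Qed.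

Lemma Lnorm_poweR (r : R) f : 0 < r ->
  ('N[mu]_r%:E[EFin \o f] `^ r = \int[mu]_x (`|f x| `^ r)%:E)%E.
Proof.
by move=> r0; rewrite powR_Lnorm ?gt_eqF//; apply: eq_integral => x _.
Qed.

Lemma Lfun_lty (r : R) f : 0 < r -> f \in Lfun mu r%:E ->
  (\int[mu]_x (`|f x| `^ r)%:E < +oo)%E.
Proof.
move=> r0; rewrite inE => /andP[_]; rewrite inE/= /finite_norm => flty.
by rewrite -Lnorm_poweR//; exact: poweR_lty.
Qed.

Lemma Lfun2_lty f : L2 mu f -> (\int[mu]_x (f x ^+ 2)%:E < +oo)%E.
Proof.
move=> f2; have := Lfun_lty (@ltr0n R 2) f2.
by under eq_integral do rewrite powR_mulrn// -normrX ger0_norm ?sqr_ge0//.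
Qed.

Lemma Lfun2_sqr f : measurable_fun setT f ->
  (\int[mu]_x (f x ^+ 2)%:E < +oo)%E -> L2 mu f.
Proof.
move=> mf flty; rewrite /L2/= inE; apply/andP; split; rewrite inE//=.
rewrite /finite_norm unlock; apply: poweR_lty; apply: le_lt_trans flty.
rewrite le_eqVlt; apply/orP; left; apply/eqP; apply: eq_integral => x _.
by rewrite /= powR_mulrn// -normrX ger0_norm ?sqr_ge0.
Qed.

Lemma integrable_L2M f g : L2 mu f -> L2 mu g ->
  mu.-integrable setT (EFin \o (f \* g)).
Proof. by move=> f2 g2; apply/Lfun1_integrable; exact: Lfun2_mul_Lfun1. Qed.

Lemma L2dotE f g : L2 mu f -> L2 mu g ->
  ((L2dot mu f g)%:E = \int[mu]_x (f x * g x)%:E)%E.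
Proof.
move=> f2 g2; rewrite /L2dot /Rintegral fineK//.
exact: integrable_fin_num (integrable_L2M f2 g2).
Qed.

Lemma L2dot_sqrE f : L2 mu f ->
  ((L2dot mu f f)%:E = \int[mu]_x (f x ^+ 2)%:E)%E.
Proof. by move=> f2; rewrite L2dotE//; apply: eq_integral => x _; rewrite expr2. Qed.

Lemma L2dotC f g : L2dot mu f g = L2dot mu g f.
Proof. by apply: eq_Rintegral => x _; rewrite mulrC. Qed.

Lemma L2dot_ge0 f : 0 <= L2dot mu f f.
Proof. by apply: Rintegral_ge0 => x _; rewrite -expr2 sqr_ge0. Qed.

Lemma L2dot_le f g : L2 mu f -> L2 mu g ->
  2 * L2dot mu f g <= L2dot mu f f + L2dot mu g g.
Proof.
move=> f2 g2; rewrite -subr_ge0.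
have [iff igg ifg] := And3 (integrable_L2M f2 f2) (integrable_L2M g2 g2)
  (integrable_L2M f2 g2).
rewrite /L2dot -RintegralD// -RintegralZl//.
rewrite -RintegralB//.
- apply: Rintegral_ge0 => x _.
  by have := sqr_ge0 (f x - g x); rewrite sqrrB; lra.
- exact: (integrableD measurableT iff igg).
- exact: (integrableZl measurableT 2 ifg).
Qed.

Lemma L2dot_ae f f' g g' : measurable_fun setT f -> measurable_fun setT f' ->
  measurable_fun setT g -> measurable_fun setT g' ->
  f = f' %[ae mu] -> g = g' %[ae mu] -> L2dot mu f g = L2dot mu f' g'.
Proof.
move=> mf mf' mg mg' ff' gg'; congr fine; apply: ae_eq_integral => //.
- exact/measurable_EFinP/measurable_funM.
- exact/measurable_EFinP/measurable_funM.
- by apply: filterS2 ff' gg' => x -> // -> //.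
Qed.

Lemma L2dot_Lnorm f : L2 mu f ->
  ((L2dot mu f f)%:E = 'N[mu]_2%:E[EFin \o f] `^ 2)%E.
Proof.
move=> f2; rewrite Lnorm_poweR ?ltr0n// L2dot_sqrE//.
by apply: eq_integral => x _; rewrite powR_mulrn// -normrX ger0_norm ?sqr_ge0.
Qed.

Lemma L2_ae f g : L2 mu f -> measurable_fun setT g -> f = g %[ae mu] -> L2 mu g.
Proof.
move=> f2 mg fg; apply: Lfun2_sqr => //.
rewrite (le_lt_trans _ (Lfun2_lty f2))// le_eqVlt; apply/orP; left; apply/eqP.
apply: ae_eq_integral => //.
- exact/measurable_EFinP/measurable_funX.
- by apply/measurable_EFinP/measurable_funX; exact: Lfun_measurable f2.
- by apply: filterS fg => x -> //.
Qed.

End square_integrable.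

(** * Contractivity of the kernel *)

Section kernel.
Context d (T : measurableType d) (R : realType).
Variable mu : {sigma_finite_measure set T -> \bar R}.
Variables (F : set (T -> R)) (E : (T -> R) -> (T -> R) -> R).
Variables (P : R -> (T -> R) -> (T -> R)) (pt : R -> T -> T -> R).
Hypothesis heat : heat_semigroup mu F E P.
Hypothesis kern : heat_kernel mu P pt.
Hypothesis cons : conservative mu pt.
Hypothesis pt_ge0 : forall t x y, 0 < t -> 0 <= pt t x y.
Implicit Types (f g v : T -> R) (s t : R).

Lemma measurable_kernel t : 0 < t ->
  measurable_fun [set: T * T] (fun z => pt t z.1 z.2).
Proof. by move=> /kern[]. Qed.

Lemma measurable_kernel1 t x : 0 < t -> measurable_fun setT (pt t x).
Proof.
move=> t0; rewrite (_ : pt t x = (fun z => pt t z.1 z.2) \o pair x)//.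
by apply: measurableT_comp => //; exact: measurable_kernel.
Qed.

Lemma measurable_kernel_op t f : 0 < t -> measurable_fun setT f ->
  measurable_fun setT (kernel_op mu pt t f).
Proof.
move=> t0 mf; pose h (z : T * T) := (pt t z.1 z.2 * f z.2)%:E.
have mh : measurable_fun setT h.
  apply/measurable_EFinP/measurable_funM; first exact: measurable_kernel.
  exact: measurableT_comp.
suff mH : measurable_fun setT (fun x => \int[mu]_y h (x, y))%E.
  exact: (measurableT_comp (fine_measurable measurableT) mH).
rewrite [X in measurable_fun _ X](_ : _ =
  (fubini_F mu h^\+ \- fubini_F mu h^\-)%E).
  apply: emeasurable_funB; apply: measurable_fun_fubini_tonelli_F => //.
    exact: measurable_funepos.
  exact: measurable_funeneg.
apply/funext => x; rewrite [LHS]integralE.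
under eq_integral do rewrite funepos_comp/=.
by under [X in (_ - X)%E]eq_integral do rewrite funeneg_comp/=.
Qed.

Lemma kernel_mass t : 0 < t ->
  \forall x \ae mu, (\int[mu]_y (pt t x y)%:E = 1)%E.
Proof.
move=> t0; apply: filterS (cons t0) => x /(_ I); rewrite /kernel_op /Rintegral/=.
under eq_integral do rewrite mulr1.
by case: integral => [r/= ->|/= /esym/eqP|/= /esym/eqP] //; rewrite oner_eq0.
Qed.

Lemma kernel_op_ae t f : 0 < t -> L2 mu f ->
  P t f = kernel_op mu pt t f %[ae mu].
Proof. by move=> t0 f2; have [_] := kern t0; exact. Qed.

(** Symmetry moves the semigroup onto an indicator, where conservativity bounds
    it by one. *)
Let kernel_mass_truncated t v (c : R) (A : set T) : 0 < t -> measurable A ->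
  (mu A < +oo)%E -> L2 mu v -> (forall x, 0 <= v x <= c) ->
  (\int[mu]_x ((\1_A x)%:E * \int[mu]_y (pt t x y * v y)%:E) <=
   \int[mu]_y (v y)%:E)%E.
Proof.
move=> t0 mA Aoo v2 vc; have mv := Lfun_measurable v2.
have v0 x : 0 <= v x by case/andP: (vc x).
have mp x := measurable_kernel1 x t0.
have A2 : L2 mu \1_A.
  apply: Lfun2_sqr; first exact: measurable_indic.
  rewrite (_ : (fun x => _) = EFin \o \1_A).
    by rewrite integral_indic// setIT.
  by apply/funext => x; rewrite /= indicE; case: (_ \in _); rewrite ?expr0n ?expr1n.
have Pv2 := heat_L2 heat (ltW t0) v2; have PA2 := heat_L2 heat (ltW t0) A2.
have mPv := Lfun_measurable Pv2; have mPA := Lfun_measurable PA2.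
have mpv : measurable_fun setT (fun z : T * T => (pt t z.1 z.2 * v z.2)%:E).
  apply/measurable_EFinP/measurable_funM; first exact: measurable_kernel.
  exact: measurableT_comp.
have step1 : (\int[mu]_x ((\1_A x)%:E * \int[mu]_y (pt t x y * v y)%:E) =
    \int[mu]_x (\1_A x * P t v x)%:E)%E.
  apply: ae_eq_integral => //.
  - apply: emeasurable_funM; first exact/measurable_EFinP/measurable_indic.
    apply: (measurable_fun_fubini_tonelli_F _ mpv) => z.
    by rewrite lee_fin mulr_ge0 ?pt_ge0.
  - by apply/measurable_EFinP/measurable_funM => //; exact: measurable_indic.
  - apply: filterS2 (kernel_mass t0) (kernel_op_ae t0 v2) => x mass Pvx _.
    rewrite EFinM Pvx// /kernel_op /Rintegral fineK// ge0_fin_numE; last first.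
      by apply: integral_ge0 => y _; rewrite lee_fin mulr_ge0 ?pt_ge0.
    apply: (@le_lt_trans _ _ (\int[mu]_y (c%:E * (pt t x y)%:E))%E); last first.
      rewrite ge0_integralZl//; [|exact/measurable_EFinP| |].
      + by rewrite mass mule1 ltry.
      + by move=> y _; rewrite lee_fin pt_ge0.
      + by rewrite lee_fin; case/andP: (vc x) => /le_trans; apply.
    apply: ge0_le_integral => //.
    + by move=> y _; rewrite lee_fin mulr_ge0 ?pt_ge0.
    + exact/measurable_EFinP/measurable_funM.
    + by apply/measurable_EFinP/measurable_funM.
    + move=> y _; rewrite lee_fin mulrC ler_wpM2r ?pt_ge0//.
      by case/andP: (vc y).
rewrite step1 -L2dotE// -(heat_symmetric heat (ltW t0))// L2dotE//.
have K0 x : 0 <= kernel_op mu pt t \1_A x.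
  by apply: Rintegral_ge0 => y _; rewrite mulr_ge0 ?pt_ge0// ?indicE.
have mK : measurable_fun setT (kernel_op mu pt t \1_A).
  by apply: measurable_kernel_op => //; exact: measurable_indic.
rewrite (@ae_eq_integral _ _ _ _ _ (fun x => (kernel_op mu pt t \1_A x * v x)%:E)) //.
- apply: ae_ge0_le_integral => //.
  + by move=> x _; rewrite lee_fin mulr_ge0.
  + exact/measurable_EFinP/measurable_funM.
  + by move=> x _; rewrite lee_fin.
  + exact/measurable_EFinP.
  + apply: filterS (kernel_mass t0) => x mass _; rewrite lee_fin ler_piMl//.
    rewrite -lee_fin /kernel_op /Rintegral.
    have le1 : (\int[mu]_y (pt t x y * \1_A y)%:E <= 1)%E.
      rewrite -mass; apply: ge0_le_integral => //.
      * by move=> y _; rewrite lee_fin mulr_ge0 ?pt_ge0// ?indicE.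
      * by apply/measurable_EFinP/measurable_funM => //; exact: measurable_indic.
      * exact/measurable_EFinP.
      * by move=> y _; rewrite lee_fin ler_piMr ?pt_ge0// indicE lern1 leq_b1.
    rewrite fineK// ge0_fin_numE ?(le_lt_trans le1) ?ltry//.
    apply: integral_ge0 => y _.
    by rewrite lee_fin mulr_ge0 ?pt_ge0// ?indicE.
- exact/measurable_EFinP/measurable_funM.
- exact/measurable_EFinP/measurable_funM.
- by apply: filterS (kernel_op_ae t0 A2) => x + _ => ->.
Qed.

(** Contractivity on L^1: exhaust the space by sets of finite measure, truncate,
    and pass to the limit by monotone convergence. *)
Lemma kernel_L1_contraction t v : 0 < t -> measurable_fun setT v ->
  (forall x, 0 <= v x) ->
  (\int[mu \x mu]_z (pt t z.1 z.2 * v z.2)%:E <= \int[mu]_y (v y)%:E)%E.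
Proof.
move=> t0 mv v0.
have [A [AT ndA mA]] := (sigma_finiteP setT mu).1 (sigma_finiteT mu).
pose w n y : R := Num.min (v y) n%:R * \1_(A n) y.
have mw n : measurable_fun setT (w n).
  apply: measurable_funM; first exact: measurable_minr.
  exact: measurable_indic (mA n).1.
have w0 n y : 0 <= w n y <= n%:R.
  rewrite /w indicE; case: (y \in A n); rewrite ?mulr1 ?mulr0 ?lexx ?ler0n//.
  by rewrite le_min v0 ler0n ge_min lexx orbT.
have wv n y : w n y <= v y.
  rewrite /w indicE; case: (y \in A n); rewrite ?mulr1 ?mulr0//.
  by rewrite ge_min lexx.
have ndA1 n m y : (n <= m)%N -> \1_(A n) y <= \1_(A m) y :> R.
  move=> nm; rewrite !indicE; case: (boolP (y \in A n)) => //= /set_mem Any.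
  by rewrite mem_set//; move/subsetPset: (ndA _ _ nm); exact.
have ndw y : {homo w ^~ y : n m / (n <= m)%N >-> n <= m}.
  move=> n m nm; rewrite /w; apply: ler_pM; last exact: ndA1.
  - by rewrite le_min v0 ler0n.
  - by rewrite indicE.
  - by rewrite le_min !ge_min lexx/= ler_nat nm orbT.
have w2 n : L2 mu (w n).
  apply: Lfun2_sqr => //.
  apply: (@le_lt_trans _ _ (\int[mu]_x ((n%:R ^+ 2)%:E * (\1_(A n) x)%:E))%E).
    apply: ge0_le_integral => //.
    - by move=> x _; rewrite lee_fin sqr_ge0.
    - exact/measurable_EFinP/measurable_funX.
    - apply: measurable_funeM; apply/measurable_EFinP.
      exact: measurable_indic (mA n).1.
    - move=> x _; rewrite lee_fin /w indicE; case: (x \in A n).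
        by rewrite !mulr1 lerXn2r ?nnegrE ?le_min ?v0 ?ler0n// ge_min lexx orbT.
      by rewrite !mulr0 expr0n.
  rewrite ge0_integralZl//; last first.
    by apply/measurable_EFinP; exact: measurable_indic (mA n).1.
  rewrite integral_indic ?setIT//; last exact: (mA n).1.
  by rewrite lte_mul_pinfty ?lee_fin ?sqr_ge0//; exact: (mA n).2.
have mpw n : measurable_fun setT (fun z : T * T => (pt t z.1 z.2 * w n z.2)%:E).
  apply/measurable_EFinP/measurable_funM; first exact: measurable_kernel.
  exact: measurableT_comp.
pose g n (z : T * T) := ((\1_(A n) z.1)%:E * (pt t z.1 z.2 * w n z.2)%:E)%E.
have mg n : measurable_fun setT (g n).
  apply: emeasurable_funM => //; apply/measurable_EFinP.
  by apply: measurableT_comp => //; exact: measurable_indic (mA n).1.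
have g0 n z : (0 <= g n z)%E.
  case/andP: (w0 n z.2) => wge0 _.
  rewrite /g -EFinM lee_fin mulr_ge0 ?indicE ?ler0n// mulr_ge0//.
  exact: pt_ge0.
have ndg z : {homo g ^~ z : n m / (n <= m)%N >-> (n <= m)%E}.
  move=> n m nm; rewrite /g -!EFinM lee_fin; apply: ler_pM; last 2 first.
  - exact: ndA1.
  - by rewrite ler_wpM2l ?pt_ge0//; exact: ndw.
  - by rewrite indicE.
  - by case/andP: (w0 n z.2) => wge0 _; rewrite mulr_ge0 ?pt_ge0.
have glim z : limn (g ^~ z) = (pt t z.1 z.2 * v z.2)%:E.
  have [n1 An1] : exists n, A n z.1.
    by have : setT z.1 by []; rewrite AT => -[n]; exists n.
  have [n2 An2] : exists n, A n z.2.
    by have : setT z.2 by []; rewrite AT => -[n]; exists n.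
  have [n3 vn3] : exists n, v z.2 <= n%:R.
    by exists (Num.truncn (v z.2)).+1; rewrite ltW// truncnS_gt.
  apply/cvg_lim => //; apply: cvg_near_cst.
  exists (maxn n1 (maxn n2 n3)) => // n /=; rewrite !geq_max => /and3P[h1 h2 h3].
  rewrite /g /w !indicE mem_set ?mul1e; last by move/subsetPset: (ndA _ _ h1); exact.
  rewrite mem_set ?mulr1; last by move/subsetPset: (ndA _ _ h2); exact.
  by rewrite min_l// (le_trans vn3)// ler_nat.
rewrite (eq_integral (fun z => limn (g ^~ z))); last by move=> z _; rewrite glim.
rewrite monotone_convergence//.
apply: lime_le.
  apply: ereal_nondecreasing_is_cvgn => n m nm.
  by apply: ge0_le_integral => // z _; exact: ndg.
apply: nearW => n; rewrite fubini_tonelli1//.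
rewrite /fubini_F /g /=.
have inner x : (\int[mu]_y ((\1_(A n) x)%:E * (pt t x y * w n y)%:E) =
    (\1_(A n) x)%:E * \int[mu]_y (pt t x y * w n y)%:E)%E.
  rewrite ge0_integralZl//.
    by apply/measurable_EFinP/measurable_funM => //; exact: measurable_kernel1.
  by move=> y _; rewrite lee_fin mulr_ge0 ?pt_ge0//; case/andP: (w0 n y).
under eq_integral do rewrite inner.
apply: le_trans (kernel_mass_truncated t0 (mA n).1 (mA n).2 (w2 n) (w0 n)) _.
apply: ge0_le_integral => //.
- by move=> y _; rewrite lee_fin; case/andP: (w0 n y).
- exact/measurable_EFinP.
- exact/measurable_EFinP.
- by move=> y _; rewrite lee_fin.
Qed.

Lemma kernel_integral_left t v : 0 < t -> measurable_fun setT v ->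
  (forall x, 0 <= v x) ->
  (\int[mu \x mu]_z (pt t z.1 z.2 * v z.1)%:E = \int[mu]_x (v x)%:E)%E.
Proof.
move=> t0 mv v0.
have mpv : measurable_fun setT (fun z : T * T => (pt t z.1 z.2 * v z.1)%:E).
  apply/measurable_EFinP/measurable_funM; first exact: measurable_kernel.
  exact: measurableT_comp.
have pv0 (z : T * T) : (0 <= (pt t z.1 z.2 * v z.1)%:E)%E.
  by rewrite lee_fin mulr_ge0 ?pt_ge0.
rewrite fubini_tonelli1//; apply: ae_eq_integral => //.
- exact: measurable_fun_fubini_tonelli_F.
- exact/measurable_EFinP.
- apply: filterS (kernel_mass t0) => x mass _; rewrite /fubini_F/=.
  under eq_integral do rewrite EFinM muleC.
  rewrite ge0_integralZl ?mass ?mule1 ?lee_fin//.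
  + by apply/measurable_EFinP; exact: measurable_kernel1.
  + by move=> y _; rewrite lee_fin pt_ge0.
Qed.

(** Integrability against almost every row of the kernel, the form in which
    L^1 contractivity makes kernel operators additive. *)
Lemma kernel_integrable t v : 0 < t -> measurable_fun setT v ->
  (forall x, 0 <= v x) -> (\int[mu]_x (v x)%:E < +oo)%E ->
  \forall x \ae mu, forall f, measurable_fun setT f ->
    (forall y, `|f y| <= 1 + v y) ->
    mu.-integrable setT (EFin \o (fun y => pt t x y * f y)).
Proof.
move=> t0 mv v0 voo.
have ip : (mu \x mu)%E.-integrable setT
    (EFin \o (fun z : T * T => pt t z.1 z.2 * v z.2)).
  apply/integrableP; split.
    apply/measurable_EFinP/measurable_funM; first exact: measurable_kernel.
    exact: measurableT_comp.
  apply: le_lt_trans voo; apply: le_trans (kernel_L1_contraction t0 mv v0).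
  rewrite le_eqVlt; apply/orP; left; apply/eqP; apply: eq_integral => z _ /=.
  by rewrite ger0_norm// mulr_ge0 ?pt_ge0.
apply: filterS2 (kernel_mass t0) (ae_integrable1 ip) => x mass ipx f mf fv.
have mp := measurable_kernel1 x t0.
have ip1 : mu.-integrable setT (EFin \o pt t x).
  apply/integrableP; split; first exact/measurable_EFinP.
  under eq_integral do rewrite /= ger0_norm ?pt_ge0//.
  by rewrite mass ltry.
apply: (le_integrable measurableT _ _ (integrableD measurableT ip1 ipx)).
  by apply/measurable_EFinP/measurable_funM.
move=> y _ /=; rewrite lee_fin normrM (ger0_norm (pt_ge0 _ _ t0)).
rewrite [leRHS]ger0_norm ?addr_ge0 ?mulr_ge0 ?pt_ge0//.
by rewrite -[X in X + _]mulr1 -mulrDr ler_wpM2l ?pt_ge0.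
Qed.

End kernel.
(** * The quadratic estimate *)

Section quadratic.
Context d (T : measurableType d) (R : realType).
Variable mu : {sigma_finite_measure set T -> \bar R}.
Variables (F : set (T -> R)) (E : (T -> R) -> (T -> R) -> R).
Variables (P : R -> (T -> R) -> (T -> R)) (pt : R -> T -> T -> R).
Hypothesis heat : heat_semigroup mu F E P.
Hypothesis kern : heat_kernel mu P pt.
Hypothesis cons : conservative mu pt.
Hypothesis pt_ge0 : forall t x y, 0 < t -> 0 <= pt t x y.
Implicit Types (f g u : T -> R) (r s t : R).

Lemma heat_dotD r s g : 0 <= r -> 0 <= s -> L2 mu g ->
  L2dot mu (P (r + s) g) g = L2dot mu (P r g) (P s g).
Proof.
move=> r0 s0 g2; have Ps2 := heat_L2 heat s0 g2; have Pr2 := heat_L2 heat r0 g2.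
rewrite (@L2dot_ae _ _ _ _ _ (P r (P s g)) _ g).
- by rewrite (heat_symmetric heat)// L2dotC.
- by apply: Lfun_measurable (heat_L2 heat _ g2); rewrite addr_ge0.
- exact: Lfun_measurable (heat_L2 heat r0 Ps2).
- exact: Lfun_measurable g2.
- exact: Lfun_measurable g2.
- exact: (heat_add heat).
- exact: aeW.
Qed.

Lemma heat_dot_midpoint r s g : 0 <= r -> 0 <= s -> L2 mu g ->
  2 * L2dot mu (P (r + s) g) g <=
  L2dot mu (P (r + r) g) g + L2dot mu (P (s + s) g) g.
Proof.
by move=> r0 s0 g2; rewrite !heat_dotD//; apply: L2dot_le; exact: (heat_L2 heat).
Qed.

Lemma heat_dot_ge0 r g : 0 <= r -> L2 mu g -> 0 <= L2dot mu (P r g) g.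
Proof.
move=> r0 g2; rewrite [r]splitr heat_dotD ?divr_ge0//.
exact: L2dot_ge0.
Qed.

Lemma heat_dot_le r g : 0 <= r -> L2 mu g -> L2dot mu (P r g) g <= L2dot mu g g.
Proof.
move=> r0 g2; have r20 : 0 <= r / 2 by rewrite divr_ge0.
rewrite [r]splitr heat_dotD// -lee_fin !L2dot_Lnorm//; last exact: (heat_L2 heat).
apply: gt0_ler_poweR => //; rewrite ?in_itv/= ?Lnorm_ge0 ?leey//.
exact: (heat_contraction heat).
Qed.

(** The function r |-> <P_r g, g> is nonnegative, at most its value at zero and
    midpoint convex. Its decrements over consecutive intervals of length s are
    therefore nonincreasing, and about t / s of them fit before time 2 t. *)
Lemma heat_dot_decrement s t g : 0 < s -> 0 < t -> L2 mu g ->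
  L2dot mu (P (t + t) g) g - L2dot mu (P (t + t + s) g) g <=
  s / t * L2dot mu g g.
Proof.
move=> s0 t0 g2; pose A r := L2dot mu (P r g) g; pose G := L2dot mu g g.
have A0 r : 0 <= r -> 0 <= A r by move=> r0; exact: heat_dot_ge0.
have AG r : 0 <= r -> A r <= G by move=> r0; exact: heat_dot_le.
have G0 : 0 <= G by exact: L2dot_ge0.
rewrite -/(A _) -/(A _) -/G; have tt0 : 0 <= t + t by lra.
have [ts|st] := ltP (t + t) s.
  apply: (@le_trans _ _ G).
    by have := AG _ tt0; have := A0 (t + t + s); lra.
  by rewrite ler_peMl// ler_pdivlMr//; lra.
(* the decrement after r is at most each of the n decrements before r, which
   telescope *)
have dec n : forall r, n%:R * s <= r ->
    n%:R * (A r - A (r + s)) <= A (r - n%:R * s) - A r.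
  elim: n => [|n IH] r nr; first by rewrite !mul0r subr0 subrr.
  have nr' : n%:R * s + s <= r by move: nr; rewrite -natr1 mulrDl mul1r.
  have ns0 : 0 <= n%:R * s by rewrite mulr_ge0// ltW.
  have rs0 : 0 <= r - s by lra.
  have mid : 2 * A r <= A (r - s) + A (r + s).
    have := @heat_dot_midpoint ((r - s) / 2) ((r + s) / 2) g.
    have -> : (r - s) / 2 + (r + s) / 2 = r by lra.
    by rewrite -!splitr; apply => //; apply: divr_ge0 => //; lra.
  have := IH (r - s); rewrite subrK => IHr.
  have {}IHr : n%:R * (A (r - s) - A r) <= A (r - s - n%:R * s) - A (r - s).
    by apply: IHr; lra.
  have -> : r - n.+1%:R * s = r - s - n%:R * s by rewrite -natr1; ring.
  have : n%:R * (A r - A (r + s)) <= n%:R * (A (r - s) - A r).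
    by rewrite ler_wpM2l//; lra.
  by rewrite -natr1 mulrDl mul1r; lra.
(* n >= 1 and n + 1 > 2 t / s together give n >= t / s *)
pose n := Num.truncn ((t + t) / s).
have [n_le n_gt] : n%:R <= (t + t) / s /\ (t + t) / s < n.+1%:R.
  by apply/andP/truncn_itv; rewrite divr_ge0// ltW.
have n1 : 1 <= n%:R :> R.
  by rewrite ler1n truncn_gt0 ler_pdivlMr// mul1r.
have ns : n%:R * s <= t + t by rewrite -ler_pdivlMr.
have tn : t <= n%:R * s.
  by move: n_gt; rewrite ltr_pdivrMr// -natr1 mulrDl mul1r; nra.
have := dec n (t + t) ns; set D := A _ - A _ => nD.
have nDG : n%:R * D <= G.
  by have := AG (t + t - n%:R * s); have := A0 _ tt0; lra.
have [D0|D0] := leP D 0.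
  by rewrite (le_trans D0)// mulr_ge0// divr_ge0// ltW.
rewrite mulrAC ler_pdivlMr//.
have : D * t <= D * (n%:R * s) by rewrite ler_wpM2l// ltW.
have : s * (n%:R * D) <= s * G by rewrite ler_wpM2l// ltW.
by nra.
Qed.

(** Expand the square: both diagonal terms are at most ||u||^2, the cross term is
    <P_s u, u>. *)
Lemma kernel_energy s u : 0 < s -> L2 mu u ->
  (\int[mu \x mu]_z ((u z.1 - u z.2) ^+ 2 * pt s z.1 z.2)%:E <=
   (2 * (L2dot mu u u - L2dot mu (P s u) u))%:E)%E.
Proof.
move=> s0 u2; have mu_ := Lfun_measurable u2; have mp := measurable_kernel kern s0.
have Ps2 := heat_L2 heat (ltW s0) u2.
have usq0 x : 0 <= u x ^+ 2 by exact: sqr_ge0.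
have msq : measurable_fun setT (fun x => u x ^+ 2) by exact: measurable_funX.
pose a (z : T * T) := pt s z.1 z.2 * u z.1 ^+ 2.
pose b (z : T * T) := pt s z.1 z.2 * u z.2 ^+ 2.
pose c (z : T * T) := pt s z.1 z.2 * (u z.1 * u z.2).
have a0 z : 0 <= a z by rewrite mulr_ge0 ?pt_ge0.
have b0 z : 0 <= b z by rewrite mulr_ge0 ?pt_ge0.
have ma : measurable_fun setT a.
  apply: measurable_funM => //.
  exact: (measurableT_comp msq measurable_fst).
have mb : measurable_fun setT b.
  apply: measurable_funM => //.
  exact: (measurableT_comp msq measurable_snd).
have mc : measurable_fun setT c.
  apply: measurable_funM => //; apply: measurable_funM.
    exact: (measurableT_comp mu_ measurable_fst).
  exact: (measurableT_comp mu_ measurable_snd).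
have intA : (\int[mu \x mu]_z (a z)%:E = (L2dot mu u u)%:E)%E.
  by rewrite L2dot_sqrE//; exact: (kernel_integral_left kern cons pt_ge0 s0 msq usq0).
have intB : (\int[mu \x mu]_z (b z)%:E <= (L2dot mu u u)%:E)%E.
  rewrite L2dot_sqrE//.
  exact: (kernel_L1_contraction heat kern cons pt_ge0 s0 msq usq0).
have ia : (mu \x mu)%E.-integrable setT (EFin \o a).
  apply/integrableP; split; first exact/measurable_EFinP.
  by under eq_integral do rewrite /= ger0_norm//; rewrite intA ltry.
have ib : (mu \x mu)%E.-integrable setT (EFin \o b).
  apply/integrableP; split; first exact/measurable_EFinP.
  under eq_integral do rewrite /= ger0_norm//.
  exact: le_lt_trans intB (ltry _).
have ic : (mu \x mu)%E.-integrable setT (EFin \o c).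
  apply: (le_integrable measurableT _ _ (integrableD measurableT ia ib)).
    exact/measurable_EFinP.
  move=> z _ /=; rewrite lee_fin normrM (ger0_norm (pt_ge0 _ _ s0)).
  rewrite [leRHS]ger0_norm ?addr_ge0// /a /b -mulrDr ler_wpM2l ?pt_ge0// normrM.
  rewrite -(real_normK (num_real (u z.1))) -(real_normK (num_real (u z.2))).
  by have := sqr_ge0 (`|u z.1| - `|u z.2|); have := sqr_ge0 (`|u z.1| + `|u z.2|); nra.
have intC : (\int[mu \x mu]_z (c z)%:E = (L2dot mu (P s u) u)%:E)%E.
  rewrite -(integral12_prod_meas1 ic) L2dotE//.
  apply: ae_eq_integral => //.
  - exact: measurable_fubini_F ic.
  - by apply/measurable_EFinP/measurable_funM => //; exact: Lfun_measurable Ps2.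
  - apply: filterS2 (kernel_integrable heat kern cons pt_ge0 s0 msq usq0 (Lfun2_lty u2))
      (kernel_op_ae kern s0 u2) => x ipx Pux _.
    have ipu : mu.-integrable setT (EFin \o (fun y => pt s x y * u y)).
      apply: ipx => // y; have := sqr_ge0 (`|u y| - 1).
      by rewrite -[u y ^+ 2]real_normK ?num_real//; nra.
    rewrite Pux// /kernel_op /Rintegral EFinM fineK; last first.
      exact: integrable_fin_num ipu.
    rewrite muleC -integralZl//; apply: eq_integral => y _.
    by rewrite /c /=; congr EFin; ring.
have ic2 := integrableZl measurableT 2 ic.
rewrite (eq_integral (fun z => ((EFin \o (a \+ b)%R) z - (2%:E * (EFin \o c) z))%E)); last first.
  by move=> z _; rewrite /a /b /c /=; congr EFin; ring.
have iab := integrableD measurableT ia ib.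
rewrite integralB//.
rewrite integralZl// intC.
have -> : (\int[mu \x mu]_z (EFin \o (a \+ b)%R) z =
    \int[mu \x mu]_z (a z)%:E + \int[mu \x mu]_z (b z)%:E)%E.
  by rewrite -integralD_EFin.
rewrite intA.
have : (\int[mu \x mu]_z (b z)%:E \is a fin_num)%E by exact: integrable_fin_num ib.
move: intB; case: integral => // B; rewrite lee_fin => BL _.
by rewrite lee_fin; lra.
Qed.

(** Spectral calculus would give this from the bound s / t for the multiplier
    (1 - exp(- s * l)) * exp(- 2 * t * l); convexity of r |-> <P_r g, g>
    replaces it. *)
Lemma heat_quadratic_estimate s t g : 0 < s -> 0 < t -> L2 mu g ->
  (\int[mu \x mu]_z ((kernel_op mu pt t g z.1 - kernel_op mu pt t g z.2) ^+ 2 *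
     pt s z.1 z.2)%:E <= (2 * (s / t) * L2dot mu g g)%:E)%E.
Proof.
move=> s0 t0 g2; set u := kernel_op mu pt t g.
have Pt2 := heat_L2 heat (ltW t0) g2.
have mu_ : measurable_fun setT u.
  by apply: (measurable_kernel_op kern) => //; exact: Lfun_measurable g2.
have Pu : P t g = u %[ae mu] by exact: kernel_op_ae.
have u2 : L2 mu u := L2_ae Pt2 mu_ Pu.
apply: le_trans (kernel_energy s0 u2) _.
rewrite lee_fin -mulrA ler_wpM2l//.
apply: le_trans (heat_dot_decrement s0 t0 g2).
have mPt := Lfun_measurable Pt2.
have -> : L2dot mu u u = L2dot mu (P (t + t) g) g.
  rewrite heat_dotD ?(ltW t0)//.
  by apply: L2dot_ae => //; exact: ae_eq_sym.
have -> : L2dot mu (P s u) u = L2dot mu (P (t + t + s) g) g.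
  have -> : t + t + s = (s + t) + t by ring.
  have st0 : 0 <= s + t by rewrite addr_ge0 ?ltW.
  rewrite heat_dotD ?(ltW t0)//.
  have mst := Lfun_measurable (heat_L2 heat st0 g2).
  have msu := Lfun_measurable (heat_L2 heat (ltW s0) u2).
  apply: L2dot_ae => //; last exact: ae_eq_sym.
  have h1 := heat_add heat (ltW s0) (ltW t0) g2.
  have h2 := heat_ae heat (ltW s0) Pt2 u2 Pu.
  by apply: filterS2 h1 h2 => x e1 e2 _; rewrite e1// e2.
by [].
Qed.

End quadratic.

(** * Interpolation *)

Section interpolation.
Context d (T : measurableType d) (R : realType).
Variable mu : {sigma_finite_measure set T -> \bar R}.
Variables (F : set (T -> R)) (E : (T -> R) -> (T -> R) -> R).
Variables (P : R -> (T -> R) -> (T -> R)) (pt : R -> T -> T -> R).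
Hypothesis heat : heat_semigroup mu F E P.
Hypothesis kern : heat_kernel mu P pt.
Hypothesis cons : conservative mu pt.
Hypothesis pt_ge0 : forall t x y, 0 < t -> 0 <= pt t x y.
Implicit Types (f g u : T -> R) (l p q r s t : R).

Definition high_part l f x := if l < `|f x| then f x else 0.
Definition low_part l f x := if l < `|f x| then 0 else f x.

Lemma measurable_high_part l f :
  measurable_fun setT f -> measurable_fun setT (high_part l f).
Proof.
move=> mf; apply: measurable_fun_ifT => //.
by apply: measurable_fun_ltr => //; exact: measurableT_comp.
Qed.

Lemma measurable_low_part l f :
  measurable_fun setT f -> measurable_fun setT (low_part l f).
Proof.
move=> mf; apply: measurable_fun_ifT => //.
by apply: measurable_fun_ltr => //; exact: measurableT_comp.
Qed.

Lemma low_part_le l f x : 0 <= l -> `|low_part l f x| <= l.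
Proof. by rewrite /low_part; case: ltP => //; rewrite normr0. Qed.

(** The exceptional null set is the same for all levels: a single integrable
    majorant of |f| against the kernel dominates every truncation. *)
Lemma kernel_op_split p t f : 1 <= p -> 0 < t -> f \in Lfun mu p%:E ->
  \forall x \ae mu, forall l,
    kernel_op mu pt t f x =
    kernel_op mu pt t (low_part l f) x + kernel_op mu pt t (high_part l f) x.
Proof.
move=> p1 t0 fp; have mf := Lfun_measurable fp.
have p0 : 0 < p by exact: lt_le_trans p1.
have mv : measurable_fun setT (fun x => `|f x| `^ p).
  apply: (measurableT_comp (measurable_powR p)).
  exact: measurableT_comp.
have v0 x : 0 <= `|f x| `^ p by exact: powR_ge0.
have fv x : `|f x| <= 1 + `|f x| `^ p.
  have [f1|f1] := leP `|f x| 1; first by have := v0 x; lra.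
  by have := le1r_powR (ltW f1) p1; lra.
apply: filterS (kernel_integrable heat kern cons pt_ge0 t0 mv v0 (Lfun_lty p0 fp)).
move=> x ipx l; rewrite /kernel_op -RintegralD//.
- by apply: eq_Rintegral => y _; rewrite /low_part /high_part;
    case: ifP; rewrite ?mulr0 ?addr0 ?add0r.
- apply: ipx => [|y]; first exact: measurable_low_part.
  by rewrite /low_part; case: ifP => // _; rewrite normr0 (le_trans _ (fv y)).
- apply: ipx => [|y]; first exact: measurable_high_part.
  by rewrite /high_part; case: ifP => // _; rewrite normr0 (le_trans _ (fv y)).
Qed.

(** Where |f| exceeds l, |f|^2 <= l^(2 - p) |f|^p. *)
Lemma high_part_L2 p l f : 2 <= p -> 0 < l -> f \in Lfun mu p%:E ->
  L2 mu (high_part l f).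
Proof.
move=> p2 l0 fp; have mf := Lfun_measurable fp.
have p0 : 0 < p by exact: lt_le_trans p2.
have mv : measurable_fun setT (fun x => (`|f x| `^ p)%:E).
  apply/measurable_EFinP/(measurableT_comp (measurable_powR p)).
  exact: measurableT_comp.
apply: Lfun2_sqr; first exact: measurable_high_part.
apply: (@le_lt_trans _ _ (\int[mu]_x ((l `^ (2 - p))%:E * (`|f x| `^ p)%:E))%E).
  apply: ge0_le_integral => //.
  - by move=> x _; rewrite lee_fin sqr_ge0.
  - exact/measurable_EFinP/measurable_funX/measurable_high_part.
  - exact: measurable_funeM.
  - move=> x _; rewrite lee_fin /high_part; case: ifPn => [lf|_]; last first.
      by rewrite expr0n mulr_ge0 ?powR_ge0.
    have f0 : 0 < `|f x| by exact: lt_trans lf.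
    rewrite -(real_normK (num_real (f x))) -powR_mulrn//.
    have -> : `|f x| `^ 2%:R = `|f x| `^ (2 - p) * `|f x| `^ p.
      by rewrite -powRD ?subrK// (gt_eqF f0) implybT.
    rewrite ler_wpM2r ?powR_ge0//.
    rewrite -[2 - p]opprB !powRN lef_pV2 ?posrE ?powR_gt0//.
    by apply: powR_le; rewrite ?(ltW l0) ?(ltW lf)//; lra.
rewrite ge0_integralZl//; last by rewrite lee_fin powR_ge0.
by rewrite lte_mul_pinfty ?lee_fin ?powR_ge0//; exact: Lfun_lty.
Qed.

(** Choosing the truncation level comparable to |a| / D, so that the bounded
    part accounts for at most half of a. *)
Lemma level_estimate q (a D : R) (b : nat -> R) : 0 < q -> 0 <= D ->
  (D = 0 -> a = 0) -> (forall n, `|a - b n| <= D * dyadic_level R n) ->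
  exists n, `|a| `^ (q + 2) <=
    4 * 4 `^ q * (D `^ q * (dyadic_level R n `^ q * b n ^+ 2)).
Proof.
move=> q0 D0 Da ab.
have [a0|a0] := eqVneq a 0.
  exists 0; rewrite a0 normr0 powR0 ?gt_eqF ?addr_gt0//.
  apply: mulr_ge0; first by rewrite mulr_ge0 ?powR_ge0.
  by apply: mulr_ge0; rewrite ?powR_ge0// mulr_ge0 ?powR_ge0 ?sqr_ge0.
have {}D0 : 0 < D.
  by rewrite lt_neqAle D0 andbT eq_sym; apply: contra_neq a0 => /Da.
have v0 : 0 < `|a| by rewrite normr_gt0.
have D20 : 0 < 2 * D by rewrite mulr_gt0.
have [n /andP[ln nl]] := @dyadic_level_approx R _ (divr_gt0 v0 D20).
move: ln nl; rewrite ler_pdivlMr// ler_pdivrMr// => ln nl.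
have l0 := @dyadic_level_gt0 R n; set l := dyadic_level R n in ln nl l0 *.
exists n; rewrite -/l.
have vb : `|a| <= 2 * `|b n|.
  have := ab n; rewrite -/l => abn.
  have : `|a| <= `|a - b n| + `|b n| by rewrite -{1}(subrK (b n) a) ler_normD.
  by lra.
rewrite powRD ?(gt_eqF v0) ?implybT// powR_mulrn//.
have -> : 4 * 4 `^ q * (D `^ q * (l `^ q * b n ^+ 2)) =
    (4 * (D * l)) `^ q * (2 * `|b n|) ^+ 2.
  rewrite !powRM ?(ltW D0) ?(ltW l0) ?mulr_ge0 ?(ltW D0) ?(ltW l0)//.
  by rewrite exprMn real_normK ?num_real//; ring.
apply: ler_pM; rewrite ?powR_ge0 ?sqr_ge0//.
- by apply: powR_le; rewrite ?(ltW q0) ?(ltW v0)//; lra.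
- by rewrite lerXn2r ?nnegrE ?mulr_ge0 ?normr_ge0.
Qed.

(** Exchanging sum and integral leaves, at each point, a geometric sum over the
    levels below |f|, which is comparable to its largest term. *)
Lemma high_part_sum p f (K : R) : 2 < p -> 
  (forall a (N : nat), 0 <= a ->
    \sum_(n < N) (if dyadic_level R n < a then dyadic_level R n `^ (p - 2) else 0)
    <= K * a `^ (p - 2)) ->
  f \in Lfun mu p%:E ->
  (\sum_(n <oo) \int[mu]_x (dyadic_level R n `^ (p - 2) *
      high_part (dyadic_level R n) f x ^+ 2)%:E <=
   K%:E * \int[mu]_x (`|f x| `^ p)%:E)%E.
Proof.
move=> p2 HK fp; have mf := Lfun_measurable fp.
have mh n : measurable_fun setT (fun x => (dyadic_level R n `^ (p - 2) *
      high_part (dyadic_level R n) f x ^+ 2)%:E).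
  apply/measurable_EFinP/measurable_funM => //.
  exact/measurable_funX/measurable_high_part.
have mv : measurable_fun setT (fun x => (`|f x| `^ p)%:E).
  apply/measurable_EFinP/(measurableT_comp (measurable_powR p)).
  exact: measurableT_comp.
have h0 n x : (0 <= (dyadic_level R n `^ (p - 2) *
      high_part (dyadic_level R n) f x ^+ 2)%:E)%E.
  by rewrite lee_fin mulr_ge0 ?powR_ge0 ?sqr_ge0.
have K0 : 0 <= K.
  by have := HK 1 0%N ler01; rewrite big_ord0 powR1 mulr1.
rewrite -integral_nneseries// -ge0_integralZl//; last first.
apply: ge0_le_integral => //.
- by move=> x _; apply: nneseries_ge0.
- exact: ge0_emeasurable_sum.
- exact: measurable_funeM.
move=> x _; apply: lime_le; first by apply: is_cvg_nneseries.
apply: nearW => N; rewrite sumEFin -EFinM lee_fin big_mkord.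
have fE : `|f x| `^ p = `|f x| `^ (p - 2) * f x ^+ 2.
  rewrite -(real_normK (num_real (f x))) -powR_mulrn// -powRD ?subrK//.
  by apply/implyP => /eqP; lra.
rewrite fE mulrA; apply: le_trans (ler_wpM2r (sqr_ge0 (f x)) (HK _ N (normr_ge0 (f x)))).
rewrite mulr_suml; apply: ler_sum => n _; rewrite /high_part.
by case: ifP => _ //; rewrite expr0n mulr0 mul0r.
Qed.

(** Interpolation of Marcinkiewicz type between the quadratic estimate and a
    bound D on differences for bounded data. Since D depends on the pair of
    points, its power is traded for a change of time from s to s' in the kernel.
    The sum over levels converges because p > 2. *)
Lemma kernel_difference_Lp p : 2 < p -> exists2 C : R, 0 < C &
  forall (D : T -> T -> R) (M s s' t : R) f,
    0 < s -> 0 < s' -> 0 < t -> 0 <= M ->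
    (forall x y, 0 <= D x y) -> (forall x y, D x y = 0 -> x = y) ->
    (forall g l, measurable_fun setT g -> 0 < l -> (forall x, `|g x| <= l) ->
      forall x y, `|kernel_op mu pt t g x - kernel_op mu pt t g y| <= D x y * l) ->
    (forall x y, D x y `^ (p - 2) * pt s x y <= M * pt s' x y) ->
    f \in Lfun mu p%:E ->
    (\int[mu]_y \int[mu]_x
       (`|kernel_op mu pt t f x - kernel_op mu pt t f y| `^ p * pt s x y)%:E <=
     (C * M * (s' / t))%:E * \int[mu]_x (`|f x| `^ p)%:E)%E.
Proof.
move=> p2; have q0 : 0 < p - 2 by rewrite subr_gt0.
have [K K0 HK] := @dyadic_level_truncated_sum R _ q0.
pose c : R := 4 * 4 `^ (p - 2).
have c0 : 0 < c by rewrite mulr_gt0// powR_gt0.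
exists (2 * c * K); first by rewrite !mulr_gt0.
move=> D M s s' t f s0 s'0 t0 M0 D0 Deq0 HD HM fp.
have mf := Lfun_measurable fp.
pose l n := dyadic_level R n; pose h n := high_part (l n) f.
have l0 n : 0 < l n by exact: dyadic_level_gt0.
have h2 n : L2 mu (h n) by exact: high_part_L2 (ltW p2) (l0 n) fp.
pose u := kernel_op mu pt t f; pose w n := kernel_op mu pt t (h n).
have mu_ : measurable_fun setT u by exact: (measurable_kernel_op kern).
have mw n : measurable_fun setT (w n).
  exact/(measurable_kernel_op kern)/(Lfun_measurable (h2 n)).
pose G (z : T * T) := (`|u z.1 - u z.2| `^ p * pt s z.1 z.2)%:E.
pose H n (z : T * T) := ((w n z.1 - w n z.2) ^+ 2 * pt s' z.1 z.2)%:E.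
have G0 z : (0 <= G z)%E by rewrite lee_fin mulr_ge0 ?powR_ge0 ?pt_ge0.
have H0 n z : (0 <= H n z)%E by rewrite lee_fin mulr_ge0 ?sqr_ge0 ?pt_ge0.
have mG : measurable_fun setT G.
  apply/measurable_EFinP/measurable_funM; last exact: (measurable_kernel kern).
  apply: (measurableT_comp (measurable_powR p)); apply: measurableT_comp => //.
  by apply: measurable_funB; apply: measurableT_comp.
have mH n : measurable_fun setT (H n).
  apply/measurable_EFinP/measurable_funM; last exact: (measurable_kernel kern).
  apply: measurable_funX.
  by apply: measurable_funB; apply: measurableT_comp.
pose S (z : T * T) := (\sum_(n <oo) ((c * M * l n `^ (p - 2))%:E * H n z))%E.
have cM0 n : 0 <= c * M * l n `^ (p - 2).
  by rewrite mulr_ge0 ?powR_ge0// mulr_ge0// ltW.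
have S0n n z : (0 <= (c * M * l n `^ (p - 2))%:E * H n z)%E.
  by apply: mule_ge0 => //; rewrite lee_fin.
have S0 z : (0 <= S z)%E by exact: nneseries_ge0.
have mS : measurable_fun setT S.
  by apply: ge0_emeasurable_sum => // n _; exact: measurable_funeM.
have p1 : 1 <= p by rewrite (le_trans _ (ltW p2))// ler1n.
have split_ae := kernel_op_split p1 t0 fp.
have GS x y : (forall m, u x = kernel_op mu pt t (low_part m f) x +
      kernel_op mu pt t (high_part m f) x) ->
    (forall m, u y = kernel_op mu pt t (low_part m f) y +
      kernel_op mu pt t (high_part m f) y) -> (G (x, y) <= S (x, y))%E.
  move=> ux uy.
  have [||n] := @level_estimate _ (u x - u y) (D x y) (fun n => w n x - w n y) q0 (D0 x y).
  - by move=> /Deq0 ->; rewrite subrr.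
  - move=> n; rewrite (ux (l n)) (uy (l n)) /w /h.
    set a := kernel_op _ _ _ (low_part _ _) x.
    set b := kernel_op _ _ _ (low_part _ _) y.
    set a' := kernel_op _ _ _ _ x; set b' := kernel_op _ _ _ _ y.
    have -> : a + a' - (b + b') - (a' - b') = a - b by ring.
    apply: HD => // [|z]; first exact: measurable_low_part.
    by apply: low_part_le; exact: ltW.
  rewrite subrK -/c => uw.
  apply: (@le_trans _ _ ((c * M * l n `^ (p - 2))%:E * H n (x, y))%E).
    rewrite /G /H -EFinM lee_fin/=.
    apply: le_trans (ler_wpM2r (pt_ge0 x y s0) uw) _.
    have -> : c * (D x y `^ (p - 2) * (dyadic_level R n `^ (p - 2) *
        (w n x - w n y) ^+ 2)) * pt s x y =
        (c * (l n `^ (p - 2) * (w n x - w n y) ^+ 2)) *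
        (D x y `^ (p - 2) * pt s x y) by rewrite /l; ring.
    have -> : c * M * l n `^ (p - 2) * ((w n x - w n y) ^+ 2 * pt s' x y) =
        (c * (l n `^ (p - 2) * (w n x - w n y) ^+ 2)) * (M * pt s' x y) by ring.
    apply: ler_wpM2l => //; apply: mulr_ge0; first exact: ltW.
    by rewrite mulr_ge0 ?powR_ge0 ?sqr_ge0.
  have := @nneseries_lim_ge R (fun n => (c * M * l n `^ (p - 2))%:E * H n (x, y))%E
    xpredT 0%N n.+1 (fun m _ _ => S0n m (x, y)).
  apply: le_trans; rewrite big_nat_recr//= leeDr// sume_ge0//.
have intS : (\int[mu \x mu]_z S z <=
    (2 * c * K * M * (s' / t))%:E * \int[mu]_x (`|f x| `^ p)%:E)%E.
  rewrite integral_nneseries//; last by move=> n; exact: measurable_funeM.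
  pose B n := (\int[mu]_x (l n `^ (p - 2) * h n x ^+ 2)%:E)%E.
  have mh2 n : measurable_fun setT (fun x => (h n x ^+ 2)%:E).
    by apply/measurable_EFinP/measurable_funX; exact: Lfun_measurable (h2 n).
  have B0 n : (0 <= B n)%E.
    apply: integral_ge0 => x _.
    by rewrite lee_fin mulr_ge0 ?powR_ge0 ?sqr_ge0.
  have st0 : 0 <= 2 * c * M * (s' / t).
    by rewrite mulr_ge0 ?divr_ge0 ?(ltW s'0) ?(ltW t0)// mulr_ge0// mulr_ge0// ltW.
  apply: (@le_trans _ _ (\sum_(n <oo) ((2 * c * M * (s' / t))%:E * B n))%E).
    apply: lee_nneseries => n _.
      move=> _; apply: integral_ge0 => z _; exact: S0n.
    rewrite ge0_integralZl// ?lee_fin//.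
    apply: le_trans (lee_wpmul2l _ (heat_quadratic_estimate heat kern cons pt_ge0
      s'0 t0 (h2 n))) _; first by rewrite lee_fin.
    rewrite /B; under [in leRHS]eq_integral do rewrite EFinM.
    rewrite ge0_integralZl//; last 2 first.
    - by move=> x _; rewrite lee_fin sqr_ge0.
    - by rewrite lee_fin powR_ge0.
    rewrite -L2dot_sqrE// -!EFinM lee_fin le_eqVlt; apply/orP; left; apply/eqP.
    by ring.
  rewrite nneseriesZl//.
  apply: le_trans (lee_wpmul2l _ (high_part_sum p2 HK fp)) _.
    by rewrite lee_fin.
  rewrite muleA -EFinM le_eqVlt; apply/orP; left; apply/eqP.
  by congr (_%:E * _)%E; ring.
apply: le_trans intS; rewrite (fubini_tonelli2 S)//.
apply: ae_ge0_le_integral => //.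
- by move=> y _; apply: integral_ge0 => x _; exact: (G0 (x, y)).
- exact: (measurable_fun_fubini_tonelli_G G).
- by move=> y _; apply: integral_ge0 => x _; exact: (S0 (x, y)).
- exact: (measurable_fun_fubini_tonelli_G S).
- apply: filterS (split_ae) => y uy _; apply: ae_ge0_le_integral => //.
  + by move=> x _; exact: (G0 (x, y)).
  + rewrite (_ : (fun x => _) = G \o (fun x => (x, y)))//.
    exact: measurableT_comp.
  + exact: measurableT_comp.
  + by apply: filterS (split_ae) => x ux _; exact: GS.
Qed.

End interpolation.

(** * Metric measure spaces *)

(** The product measure needs sigma-finiteness as a structure, while here it is
    a consequence of the volume bounds. *)
Lemma sigma_finite_measureP d (T : measurableType d) (R : realType)
    (mu : {measure set T -> \bar R}) : sigma_finite setT mu ->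
  exists nu : {sigma_finite_measure set T -> \bar R},
    nu = mu :> {measure set T -> \bar R}.
Proof.
case: mu => m [a b] sf.
pose m' : {measure set T -> \bar R} := Measure.Pack (@Measure.Class _ _ _ m a b).
pose nu : {sigma_finite_measure set T -> \bar R} :=
  HB.pack (Measure.sort m') (Measure_isSigmaFinite.Build _ _ _ m' sf).
by exists nu.
Qed.

Section metric.
Context (R : realType) (X : completeMetricType R).
Implicit Types x y : X.

Lemma open_mdist_ball x (r : R) : open (ball x r).
Proof.
rewrite openE => y; rewrite ballEmdist/= => xyr.
apply/nbhs_ballP; exists ((r - mdist x y) / 2) => /=.
  by rewrite divr_gt0// subr_gt0.
move=> z yz.
have xy : ball x ((r + mdist x y) / 2) y by rewrite ballEmdist/=; lra.
have := ball_triangle xy yz; rewrite [X in ball _ X](_ : _ = r); last by field.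
by rewrite ballEmdist.
Qed.

Lemma volume_growth_sigma_finite (mu : {measure set (borel X) -> \bar R})
    (alpha1 alpha2 : R) :
  volume_growth mu alpha1 alpha2 -> sigma_finite setT mu.
Proof.
move=> [C C0 vol]; pose x0 : X := point.
exists (fun n : nat => ball x0 n.+1%:R).
  apply/seteqP; split => // x _; exists (Num.truncn (mdist x0 x)) => //.
  by rewrite ballEmdist/= truncnS_gt.
move=> n; split.
  by apply: sub_sigma_algebra; exact: open_mdist_ball.
by have [_ volx] := vol x0 _ (ltr0Sn R n); exact: le_lt_trans volx (ltry _).
Qed.

End metric.

Lemma Lfun_infty_bounded d (T : measurableType d) (R : realType)
    (mu : {measure set T -> \bar R}) (g : T -> R) (l : R) : 0 <= l ->
  measurable_fun setT g -> (forall x, `|g x| <= l) ->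
  g \in Lfun mu +oo%E /\ ('N[mu]_+oo[EFin \o g] <= l%:E)%E.
Proof.
move=> l0 mg gl.
have Nl : ('N[mu]_+oo[EFin \o g] <= l%:E)%E.
  rewrite unlock /Lnorm; case: ifPn => _; last by rewrite lee_fin.
  by apply/ess_supP; apply: aeW => x; rewrite /= lee_fin.
split => //; rewrite inE; apply/andP; split; rewrite inE//=.
exact: le_lt_trans Nl (ltry _).
Qed.

(** The exponents of Psi_p interpolate those of the two endpoint scales, which
    reappear separately in its p-th power. *)
Lemma seminorm_scale_powR (R : realType) (a b p x : R) : 0 < p -> 0 < x ->
  two_power ((1 - 2 / p) * a + 1 / p) ((1 - 2 / p) * b + 1 / p) x `^ p =
  two_power a b x `^ (p - 2) * x.
Proof.
move=> p0 x0; rewrite two_power_affine// powRM ?powR_ge0// -!powRrM.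
rewrite mulrBl mul1r mulfVK ?gt_eqF// mul1r mulVf ?gt_eqF// powRr1//.
exact: ltW.
Qed.

Theorem theorem3p10 (R : realType) (X : completeMetricType R)
    (mu : {measure set (borel X) -> \bar R})
    (F : set (borel X -> R)) (E : (borel X -> R) -> (borel X -> R) -> R)
    (P : R -> (borel X -> R) -> (borel X -> R))
    (pt : R -> borel X -> borel X -> R)
    (alpha1 alpha2 beta1 beta2 kappa1 kappa2 p : R) :
  locally_compact [set: X] ->
  radon mu ->
  doubling_positive mu ->
  dirichlet_form mu F E ->
  heat_semigroup mu F E P ->
  heat_kernel mu P pt ->
  conservative mu pt ->
  1 <= alpha1 -> 1 <= alpha2 ->
  volume_growth mu alpha1 alpha2 ->
  2 <= beta1 <= 1 + alpha1 -> 2 <= beta2 <= 1 + alpha2 ->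
  heat_kernel_estimates alpha1 alpha2 beta1 beta2 pt ->
  0 < kappa1 -> 0 < kappa2 ->
  wBE mu beta1 beta2 kappa1 kappa2 pt ->
  2 <= p ->
  let Psi := two_power ((1 - 2 / p) * (kappa1 / beta1) + 1 / p)
                       ((1 - 2 / p) * (kappa2 / beta2) + 1 / p) in
  exists2 C : R, 0 < C &
    forall (f : borel X -> R) (t : R), f \in Lfun mu p%:E -> 0 < t ->
      (heat_seminorm mu pt p Psi (kernel_op mu pt t f) <=
       (C / Psi t)%:E * 'N[mu]_p%:E[EFin \o f])%E.
Proof.
move=> _ _ _ _ heat kern cons _ _ vol /andP[b1 _] /andP[b2 _].
move=> [c1 [C1 [c2 [C2 [c10 C10 c20 C20 bounds]]]]] k1 k2 [Cw Cw0 lip] p2 Psi.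
have [nu nuE] := sigma_finite_measureP (volume_growth_sigma_finite vol).
subst mu.
have pt_ge0 t x y : 0 < t -> 0 <= pt t x y.
  move=> t0; have [lower _] := bounds x y t t0; apply: le_trans lower.
  by rewrite mulr_ge0 ?expR_ge0// divr_ge0 ?(ltW C10)// two_power_ge0// ltW.
have p0 : 0 < p by exact: lt_le_trans p2.
pose S := two_power (kappa1 / beta1) (kappa2 / beta2).
have S0 t : 0 < t -> 0 < S t by exact: two_power_gt0.
have [C0 C00 main] : exists2 C0 : R, 0 < C0 & forall f s t,
    f \in Lfun nu p%:E -> 0 < s -> 0 < t ->
    (\int[nu]_y \int[nu]_x (`|kernel_op nu pt t f x - kernel_op nu pt t f y| `^ p
       * pt s x y)%:E <=
     (C0 * ((S s / S t) `^ (p - 2) * (s / t)))%:E * \int[nu]_x (`|f x| `^ p)%:E)%E.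
  (* at p = 2 the sum over levels diverges, but the quadratic estimate applies
     directly *)
  move: p2; rewrite le_eqVlt => /predU1P[p2|p2].
    exists 2 => // f s t; rewrite -p2 => f2 s0 t0.
    rewrite subrr powRr0 mul1r.
    have sqrE (a : R) : `|a| `^ 2 = a ^+ 2.
      by rewrite powR_mulrn// real_normK// num_real.
    under eq_integral do under eq_integral do rewrite sqrE.
    under [in leRHS]eq_integral do rewrite sqrE.
    have mf := Lfun_measurable f2.
    have mu_ := measurable_kernel_op kern t0 mf.
    rewrite -(fubini_tonelli2 (fun z : borel X * borel X => ((kernel_op nu pt t f z.1 -
      kernel_op nu pt t f z.2) ^+ 2 * pt s z.1 z.2)%:E)) -?L2dot_sqrE -?EFinM//.
    - exact: (heat_quadratic_estimate heat kern cons pt_ge0).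
    - apply/measurable_EFinP/measurable_funM; last exact: (measurable_kernel kern).
      apply: measurable_funX.
      by apply: measurable_funB; apply: measurableT_comp.
    - by move=> z; rewrite lee_fin mulr_ge0 ?sqr_ge0 ?pt_ge0.
  have q0 : 0 <= p - 2 by rewrite subr_ge0 ltW.
  have [L [K [L1 K0 absorb]]] := @distance_power_absorption R alpha1 alpha2
    beta1 beta2 kappa1 kappa2 (p - 2) c1 C1 c2 C2 b1 b2 k1 k2 q0 c10 C10 c20 C20.
  have [C C_gt0 diff] := kernel_difference_Lp heat kern cons pt_ge0 p2.
  have L0 : 0 < L by exact: lt_le_trans L1.
  exists (C * (Cw `^ (p - 2) * K) * L).
    by rewrite !mulr_gt0 ?powR_gt0.
  move=> f s t fp s0 t0.
  pose D (x y : X) := Cw * (two_power kappa1 kappa2 (mdist x y) / S t).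
  pose M := Cw `^ (p - 2) * K * (S s / S t) `^ (p - 2).
  have dist0 (x y : X) : 0 <= mdist x y by exact: mdist_ge0.
  have -> : C * (Cw `^ (p - 2) * K) * L * ((S s / S t) `^ (p - 2) * (s / t)) =
      C * M * (L * s / t) by rewrite /M; ring.
  apply: (diff D M s (L * s) t f) => //.
  - exact: mulr_gt0.
  - by rewrite /M !mulr_ge0 ?powR_ge0// ltW.
  - move=> x y; rewrite /D mulr_ge0 ?(ltW Cw0)// divr_ge0 ?two_power_ge0//.
    by rewrite ltW// S0.
  - move=> x y /eqP; rewrite /D !mulf_eq0 invr_eq0 (gt_eqF Cw0) (gt_eqF (S0 _ t0)) orbF => /eqP dxy.
    apply: mdist_positivity; apply/eqP; rewrite eq_le dist0 andbT leNgt.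
    by apply/negP => /(two_power_gt0 kappa1 kappa2); rewrite dxy ltxx.
  - move=> g l mg l0 gl x y.
    have [goo gN] := @Lfun_infty_bounded _ _ _ nu g l (ltW l0) mg gl.
    rewrite -lee_fin; apply: le_trans (lip x y t g t0 goo) _.
    rewrite [leRHS]EFinM; apply: lee_wpmul2l => //.
    rewrite lee_fin mulr_ge0 ?(ltW Cw0)// divr_ge0 ?two_power_ge0//.
    by rewrite ltW.
  - move=> x y.
    have -> : D x y `^ (p - 2) = Cw `^ (p - 2) *
        (two_power kappa1 kappa2 (mdist x y) `^ (p - 2) / S t `^ (p - 2)).
      have Sd0 : 0 <= two_power kappa1 kappa2 (mdist x y).
        exact: two_power_ge0.
      rewrite /D powRM ?divr_ge0 ?(ltW Cw0) ?(ltW (S0 _ t0))//.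
      by rewrite powR_div// ltW// S0.
    have -> : M = Cw `^ (p - 2) * (K * S s `^ (p - 2) / S t `^ (p - 2)).
      rewrite /M powR_div ?(ltW (S0 _ _))//.
      by rewrite -!mulrA.
    rewrite -!mulrA ler_wpM2l ?powR_ge0// !mulrA.
    rewrite mulrAC [leRHS]mulrAC ler_wpM2r ?invr_ge0 ?powR_ge0//.
    have [_ upper] := bounds x y s s0.
    have Ls0 : 0 < L * s by exact: mulr_gt0.
    have [lower _] := bounds x y (L * s) Ls0.
    apply: le_trans (ler_wpM2l (powR_ge0 _ _) upper) _.
    apply: le_trans (absorb s (mdist x y) s0 (dist0 x y)) _.
    by rewrite ler_wpM2l// mulr_ge0 ?powR_ge0// ltW.
have Psi0 t : 0 < t -> 0 < Psi t by exact: two_power_gt0.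
exists (C0 `^ p^-1); first exact: powR_gt0.
move=> f t fp t0; apply: ge_ereal_sup => _ [s /= s0 <-].
have ratio : (S s / S t) `^ (p - 2) * (s / t) = (Psi s / Psi t) `^ p.
  have PsiE r : 0 < r -> Psi r `^ p = S r `^ (p - 2) * r.
    exact: seminorm_scale_powR.
  rewrite !powR_div ?(ltW (S0 _ _)) ?(ltW (Psi0 _ _))// !PsiE//.
  by rewrite invfM mulrACA.
have := main f s t fp s0 t0; rewrite ratio -Lnorm_poweR// => main_st.
have N0 := Lnorm_ge0 nu p%:E (EFin \o f).
set N := Lnorm _ _ _ in main_st N0 *.
have ratio0 : 0 <= Psi s / Psi t by rewrite divr_ge0// ltW// Psi0.
apply: (@le_trans _ _ ((Psi s)%:E^-1 *
    ((C0 * (Psi s / Psi t) `^ p)%:E * N `^ p) `^ p^-1)%E).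
  apply: lee_wpmul2l; first by rewrite inver gt_eqF ?Psi0// lee_fin invr_ge0 ltW// Psi0.
  apply: gt0_ler_poweR main_st.
  - by rewrite invr_ge0 ltW.
  - rewrite in_itv/= leey andbT; apply: integral_ge0 => y _.
    by apply: integral_ge0 => x _; rewrite lee_fin mulr_ge0 ?powR_ge0 ?pt_ge0.
  - rewrite in_itv/= leey andbT mule_ge0 ?poweR_ge0// lee_fin.
    by rewrite mulr_ge0 ?powR_ge0// ltW.
rewrite poweRM ?poweR_ge0 ?lee_fin ?mulr_ge0 ?powR_ge0 ?(ltW C00)//.
rewrite -poweRrM mulfV ?gt_eqF// poweRe1// poweR_EFin.
rewrite powRM ?powR_ge0 ?(ltW C00)// -powRrM mulfV ?gt_eqF// powRr1//.
rewrite inver gt_eqF ?Psi0// muleA -EFinM le_eqVlt; apply/orP; left; apply/eqP.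
congr (_%:E * _)%E; have := Psi0 s s0; have := Psi0 t t0.
by move=> /lt0r_neq0 ? /lt0r_neq0 ?; field; apply/andP.
Qed.
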